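(* Let $(M,\omega)$ be a connected symplectic manifold (open or closed), and let $X_0,X_1,Y_0,Y_1\subset M$ be compact sets with $X_0\cap X_1=Y_0\cap Y_1=\emptyset$. Then $$pb_4(X_0,X_1,Y_0,Y_1)=T(X_0,X_1,Y_0,Y_1)^{-1}.$$
   Context: $C^\infty_c(M)$ is the space of smooth compactly supported real functions on $M$ with the norm $\|F\|=\max_M|F|$. The Hamiltonian vector field of $F$ is given by $i_{\mathrm{sgrad}F}\,\omega=-dF$, and $\{F,G\}=\omega(\mathrm{sgrad}\,G,\mathrm{sgrad}\,F)$. $pb_4(X_0,X_1,Y_0,Y_1)=\inf\|\{F,G\}\|$ over all $F,G\in C_c^\infty(M)$ with $F|_{X_0}\le 0$, $F|_{X_1}\ge 1$, $G|_{Y_0}\le 0$, $G|_{Y_1}\ge 1$. For $G\in C_c^\infty(M)$ with Hamiltonian flow $g_t$, $T(X_0,X_1;G)$ is the minimal time-length of a Hamiltonian chord of $G$ connecting $X_0$ and $X_1$: $T(X_0,X_1;G)=\inf\{|T|: T\in\mathbb R,\ \exists x\in X_0 \text{ with } g_Tx\in X_1\}$, with $\inf\emptyset=+\infty$. Put $$T(X_0,X_1,Y_0,Y_1)=\sup\{T(X_0,X_1;G): G\in C_c^\infty(M),\ G|_{Y_0}\le 0,\ G|_{Y_1}\ge 1\}.$$ Convention: $(+\infty)^{-1}=0$. *)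

(* Defs.v *)
From HB Require Import structures.
From mathcomp Require Import all_boot all_order all_algebra.
From mathcomp Require Import all_classical all_reals all_analysis.

Set Implicit Arguments.
Unset Strict Implicit.
Unset Printing Implicit Defensive.

Import Order.TTheory GRing.Theory Num.Theory.
Import numFieldNormedType.Exports.

Local Open Scope classical_set_scope.
Local Open Scope ring_scope.

Section EuclideanSmoothness.
Context {R : realType} {n : nat}.
Implicit Types (U : set 'rV[R]_n) (f : 'rV[R]_n -> R).

Definition partial (i : 'I_n) f : 'rV[R]_n -> R :=
  fun x => 'D_(delta_mx 0 i) f x.

Fixpoint Ck_on (k : nat) U f : Prop :=
  if k is k'.+1 then
    (forall x, U x -> differentiable f x) /\
    (forall i, Ck_on k' U (partial i f))
  else forall x, U x -> {for x, continuous f}.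

Definition smooth_on U f : Prop := forall k, Ck_on k U f.

End EuclideanSmoothness.

Section DifferentialFacts.
Context {R : realType}.

Lemma near_eq_diff (V W : normedModType R) (f g : V -> W) (x : V) :
  (\forall y \near x, f y = g y) -> differentiable f x ->
  differentiable g x /\ 'd g x = 'd f x :> (V -> W).
Proof.
move=> fg df; have fgx : f x = g x by exact: nbhs_singleton fg.
have cdf : continuous ('d f x) by exact: diff_continuous.
have H : g \o shift x = cst (g x) + 'd f x +o_ (0 : V) id.
  apply/eqaddoP => e e0; have /diff_locally/eqaddoP/(_ e e0) := df.
  have fg0 : \forall y \near (0 : V), f (y + x) = g (y + x).
    move: fg; rewrite (near_shift 0 x); apply: filterS => y /=.
    by rewrite subr0.
  apply: filterS2 fg0 => y /= fgy.
  by rewrite !fctE /= -fgy -fgx.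
have dgE := diff_unique cdf H; split=> //.
by apply/diff_locallyP; rewrite dgE.
Qed.

Lemma differentiable_row (V : normedModType R) (n : nat) (f : V -> 'rV[R]_n)
    (x : V) :
  (forall k, differentiable (fun y => f y 0 k) x) -> differentiable f x.
Proof.
move=> df.
rewrite (_ : f = \sum_(k < n) fun y => f y 0 k *: (delta_mx 0 k : 'rV[R]_n)).
  by apply: differentiable_sum => k; exact: differentiableZl.
by apply/funext => y; rewrite fct_sumE; exact: row_sum_delta.
Qed.

Lemma diff_partialE (n : nat) (f : 'rV[R]_n -> R) (x v : 'rV[R]_n) :
  differentiable f x -> 'd f x v = \sum_i v 0 i * partial i f x.
Proof.
move=> df; rewrite [in LHS](row_sum_delta v) linear_sum.
by apply: eq_bigr => i _; rewrite linearZ /= /partial deriveE.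
Qed.

End DifferentialFacts.

(* Both maps are total; their values off [cdom] and [cimg] are irrelevant. *)
Record chart (R : realType) (n : nat) (M : topologicalType) := Chart {
  cdom : set M;
  cfwd : M -> 'rV[R]_n;
  cbwd : 'rV[R]_n -> M;
  cdom_open : open cdom;
  cimg_open : open (cfwd @` cdom);
  cfwdK : forall p, cdom p -> cbwd (cfwd p) = p;
  cfwd_continuous : forall p, cdom p -> {for p, continuous cfwd};
  cbwd_continuous : forall x, (cfwd @` cdom) x -> {for x, continuous cbwd}
}.

Definition cimg (R : realType) (n : nat) (M : topologicalType)
  (c : chart R n M) : set 'rV[R]_n := cfwd c @` cdom c.

Record smooth_manifold (R : realType) (n : nat) (M : topologicalType) :=
  SmoothManifold {
  manifold_hausdorff : hausdorff_space M;
  manifold_second_countable : @second_countable M;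
  atlas_index : Type;
  atlas : atlas_index -> chart R n M;
  atlas_cover : forall p, exists i, cdom (atlas i) p;
  atlas_smooth : forall i j (k : 'I_n),
    smooth_on (cfwd (atlas i) @` (cdom (atlas i) `&` cdom (atlas j)))
      (fun x => cfwd (atlas j) (cbwd (atlas i) x) 0 k)
}.

Definition bilin (R : realType) (n : nat) (W : 'M[R]_n) (u v : 'rV[R]_n) : R :=
  (u *m W *m v^T) 0 0.

(* Tangent vectors at p are represented by their row of coordinates in a
   chart around p, and the 2-form by its Gram matrix [omega i p] at p in the
   chart i. Nondegeneracy forces n to be even. *)
Record symplectic_form (R : realType) (n : nat) (M : topologicalType)
    (A : smooth_manifold R n M) := SymplecticForm {
  omega : atlas_index A -> M -> 'M[R]_n;
  omega_smooth : forall i a b,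
    smooth_on (cimg (atlas i)) (fun x => omega i (cbwd (atlas i) x) a b);
  omega_transition : forall i j p (u v : 'rV[R]_n),
    cdom (atlas i) p -> cdom (atlas j) p ->
    let dt := 'd (cfwd (atlas j) \o cbwd (atlas i)) (cfwd (atlas i) p) in
    bilin (omega i p) u v = bilin (omega j p) (dt u) (dt v);
  omega_skew : forall i p, cdom (atlas i) p -> (omega i p)^T = - omega i p;
  omega_nondegenerate : forall i p,
    cdom (atlas i) p -> omega i p \in unitmx;
  omega_closed : forall i x (a b c : 'I_n), cimg (atlas i) x ->
    let w a b := fun x => omega i (cbwd (atlas i) x) a b in
    partial a (w b c) x + partial b (w c a) x + partial c (w a b) x = 0
}.

Section Hamiltonian.
Context {R : realType} {n : nat} {M : topologicalType}.
Context {A : smooth_manifold R n M} (om : symplectic_form A).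
Implicit Types (F G : M -> R) (i : atlas_index A) (p : M) (X Y : set M).

Definition smooth_fun F : Prop :=
  forall i, smooth_on (cimg (atlas i)) (F \o cbwd (atlas i)).

Definition Cinfty_c F : Prop :=
  smooth_fun F /\ compact (closure [set p | F p != 0]).

Definition sup_norm F : R := sup [set `|F p| | p in [set: M]].

Definition local_grad F i p : 'rV[R]_n :=
  \row_a partial a (F \o cbwd (atlas i)) (cfwd (atlas i) p).

(* Coordinates of sgrad F at p in the chart i; see [sgradP]. *)
Definition sgrad F i p : 'rV[R]_n := - local_grad F i p *m invmx (omega om i p).

Definition chart_at p : atlas_index A := projT1 (cid (atlas_cover A p)).

(* The choice of the chart is immaterial; see [poissonE]. *)
Definition poisson F G : M -> R := fun p =>
  let i := chart_at p in bilin (omega om i p) (sgrad G i p) (sgrad F i p).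

Lemma smooth_fun_differentiable F i p : smooth_fun F -> cdom (atlas i) p ->
  differentiable (F \o cbwd (atlas i)) (cfwd (atlas i) p).
Proof. by move=> sF ip; have [+ _] := sF i 1; apply; exists p. Qed.

Lemma sgradP F i p : smooth_fun F -> cdom (atlas i) p ->
  forall u : 'rV[R]_n,
    (forall v, bilin (omega om i p) u v =
               - 'd (F \o cbwd (atlas i)) (cfwd (atlas i) p) v)
    <-> u = sgrad F i p.
Proof.
move=> sF ip.
have dF v : 'd (F \o cbwd (atlas i)) (cfwd (atlas i) p) v =
            (local_grad F i p *m v^T) 0 0.
  rewrite diff_partialE; last exact: smooth_fun_differentiable.
  by rewrite mxE; apply: eq_bigr => k _; rewrite !mxE mulrC.
have W := omega_nondegenerate om ip.
move=> u; have sP v : bilin (omega om i p) (sgrad F i p) v =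
    - 'd (F \o cbwd (atlas i)) (cfwd (atlas i) p) v.
  by rewrite /bilin /sgrad mulmxKV// dF mulNmx mxE.
split=> [H|-> //].
apply: (can_inj (mulmxK W)); apply/rowP => k.
have := H (delta_mx 0 k); rewrite -sP /bilin !trmx_delta -!colE.
by rewrite !mxE.
Qed.

Lemma transition_differentiable (i j : atlas_index A) p :
  cdom (atlas i) p -> cdom (atlas j) p ->
  differentiable (cfwd (atlas j) \o cbwd (atlas i)) (cfwd (atlas i) p).
Proof.
move=> ip jp; apply: differentiable_row => k.
by have [+ _] := @atlas_smooth _ _ _ A i j k 1; apply; exists p.
Qed.

Lemma cbwd_near (i j : atlas_index A) p : cdom (atlas i) p -> cdom (atlas j) p ->
  \forall y \near cfwd (atlas i) p,
    cimg (atlas i) y /\ cdom (atlas j) (cbwd (atlas i) y).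
Proof.
move=> ip jp; have xi : cimg (atlas i) (cfwd (atlas i) p) by exists p.
apply: filterI; first by apply: open_nbhs_nbhs; split=> //; exact: cimg_open.
have := cbwd_continuous xi; apply; rewrite cfwdK//.
by apply: open_nbhs_nbhs; split=> //; exact: cdom_open.
Qed.

Lemma diff_transitionK (i j : atlas_index A) p (w : 'rV[R]_n) :
  cdom (atlas i) p -> cdom (atlas j) p ->
  'd (cfwd (atlas j) \o cbwd (atlas i)) (cfwd (atlas i) p)
    ('d (cfwd (atlas i) \o cbwd (atlas j)) (cfwd (atlas j) p) w) = w.
Proof.
move=> ip jp; set t := cfwd (atlas i) \o cbwd (atlas j).
set t' := cfwd (atlas j) \o cbwd (atlas i).
have tE : t (cfwd (atlas j) p) = cfwd (atlas i) p by rewrite /t /= cfwdK.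
have dt : differentiable t (cfwd (atlas j) p).
  exact: transition_differentiable.
have dt' : differentiable t' (t (cfwd (atlas j) p)).
  by rewrite tE; exact: transition_differentiable.
have [|_ idE] := near_eq_diff _ (differentiable_comp dt dt') (g := id).
  apply: filterS (cbwd_near jp ip) => y [[q jq <-] iq].
  by rewrite /t /t' /= cfwdK// cfwdK.
have cid := @diff_lin R _ _ idfun (cfwd (atlas j) p) (fun x => cvg_id).
have /(congr1 (@^~ w)) /= := diff_comp dt dt'; rewrite tE => <-.
by rewrite -(congr1 (@^~ w) idE) cid.
Qed.

Lemma diff_transition F (i j : atlas_index A) p (v : 'rV[R]_n) : smooth_fun F ->
  cdom (atlas i) p -> cdom (atlas j) p ->
  'd (F \o cbwd (atlas j)) (cfwd (atlas j) p)
    ('d (cfwd (atlas j) \o cbwd (atlas i)) (cfwd (atlas i) p) v) =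
  'd (F \o cbwd (atlas i)) (cfwd (atlas i) p) v.
Proof.
move=> sF ip jp; set t := cfwd (atlas j) \o cbwd (atlas i).
have tE : t (cfwd (atlas i) p) = cfwd (atlas j) p by rewrite /t /= cfwdK.
have dt : differentiable t (cfwd (atlas i) p).
  exact: transition_differentiable.
have dF : differentiable (F \o cbwd (atlas j)) (t (cfwd (atlas i) p)).
  by rewrite tE; exact: smooth_fun_differentiable.
have [|_ FE] := near_eq_diff _ (differentiable_comp dt dF)
    (g := F \o cbwd (atlas i)).
  by apply: filterS (cbwd_near ip jp) => y [_ jy]; rewrite /t /= cfwdK.
have cE := diff_comp dt dF; rewrite -tE.
exact: (etrans (esym (congr1 (@^~ v) cE)) (esym (congr1 (@^~ v) FE))).
Qed.

Lemma sgrad_transition F (i j : atlas_index A) p : smooth_fun F ->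
  cdom (atlas i) p -> cdom (atlas j) p ->
  'd (cfwd (atlas j) \o cbwd (atlas i)) (cfwd (atlas i) p) (sgrad F i p) =
  sgrad F j p.
Proof.
move=> sF ip jp; apply/(sgradP sF jp) => w.
pose w' := 'd (cfwd (atlas i) \o cbwd (atlas j)) (cfwd (atlas j) p) w.
have wE : 'd (cfwd (atlas j) \o cbwd (atlas i)) (cfwd (atlas i) p) w' = w.
  exact: diff_transitionK.
have trE := omega_transition om (sgrad F i p) w' ip jp.
rewrite /= wE in trE.
apply: (etrans (esym trE)).
have sP := (sgradP sF ip (sgrad F i p)).2 erefl w'.
apply: (etrans sP); congr (- _).
apply: (etrans (esym (diff_transition w' sF ip jp))).
by rewrite wE.
Qed.

Lemma poissonE F G i p : smooth_fun F -> smooth_fun G -> cdom (atlas i) p ->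
  poisson F G p = bilin (omega om i p) (sgrad G i p) (sgrad F i p).
Proof.
move=> sF sG ip; have jp := projT2 (cid (atlas_cover A p)).
rewrite /poisson (omega_transition om _ _ jp ip).
by rewrite (sgrad_transition sF jp ip) (sgrad_transition sG jp ip).
Qed.

Definition is_ham_flow G (g : R -> M -> M) : Prop := forall x,
  [/\ g 0 x = x,
      continuous (fun t => g t x) &
      forall t i, cdom (atlas i) (g t x) ->
        is_derive t (1 : R) (fun s => cfwd (atlas i) (g s x))
          (sgrad G i (g t x))].

Local Open Scope ereal_scope.

(* For G in [Cinfty_c] the flow exists, is complete and is unique, so the
   quantifier over g just names it. *)
Definition chord_time X0 X1 G : \bar R :=
  ereal_inf [set `|t|%:E | t in
    [set t : R | exists g x, [/\ is_ham_flow G g, X0 x & X1 (g t x)]]].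

Definition separates F X0 X1 : Prop :=
  (forall x, X0 x -> (F x <= 0)%R) /\ (forall x, X1 x -> (1 <= F x)%R).

Definition T4 X0 X1 Y0 Y1 : \bar R :=
  ereal_sup [set chord_time X0 X1 G | G in
    [set G | Cinfty_c G /\ separates G Y0 Y1]].

Definition pb4 X0 X1 Y0 Y1 : \bar R :=
  ereal_inf [set (sup_norm (poisson FG.1 FG.2))%:E | FG in
    [set FG : (M -> R) * (M -> R) |
      [/\ Cinfty_c FG.1, Cinfty_c FG.2,
          separates FG.1 X0 X1 & separates FG.2 Y0 Y1]]].

End Hamiltonian.

(* Main.v *)
Require Import Defs.
From mathcomp Require Import all_boot all_order all_algebra.
From mathcomp Require Import all_classical all_reals all_analysis.
From mathcomp Require Import ring lra.

Set Implicit Arguments.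
Unset Strict Implicit.
Unset Printing Implicit Defensive.

Import Order.TTheory GRing.Theory Num.Theory.
Import numFieldNormedType.Exports.

Local Open Scope classical_set_scope.
Local Open Scope ring_scope.

(* Along a Hamiltonian chord of G one has d/dt F = {F, G}, so a chord from
   {F <= 0} to {F >= 1} lasts at least 1 / ||{F, G}||: this is one inequality.
   Conversely, let every chord of G from X0 to X1 last longer than tau, and let
   u be a cutoff vanishing on the forward orbits g_[0, tau] X0 and equal to 1
   on g_[0, tau] X1, which are disjoint. The average of u over
   the flow during the time tau vanishes on X0, is 1 on X1, and its bracket with
   G is (u o g_tau - u) / tau, of norm at most 1 / tau.

   To avoid the smooth dependence of flows on initial conditions, the
   average is taken in a Euclidean space: finitely many compactly supported
   functions Phi embed X0, X1 and the support of G into R^N, and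
   sgrad G is Phi-related to a compactly supported vector field W of R^N. The
   flow of W is approximated by the iterates of the Euler step
   y |-> y + h W(y), which are smooth by composition, so that the discrete
   average of u along them is smooth; its derivative along W is within O(h) of
   the expected value. The flow of G itself on M is obtained from that of W,
   which preserves Phi(M). *)

(** * Differential calculus of smooth functions *)

(** [chord_time] only sees times realised by some g with [is_ham_flow], so a lower bound on it says
    nothing until a flow of G has been exhibited; this is why the flow on M has to be constructed.
    If the two orbit tubes met, theta_s (Phi x0) = theta_t (Phi x1) would give a chord of signed
    time s - t in [-tau, tau]: this is where the absolute value of the time enters. Euler iterates
    only shadow true orbits, so the cutoff must be constant on neighbourhoods of the tubes of a
    definite width; a Lipschitz cutoff composed with a step has this property. The O(h) errors are
    harmless because [pb4] is an infimum: brackets of norm at most 1 / tau + e for every e > 0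
    suffice. Finally, Phi sends the complement of a compact set to 0, and W 0 = 0; adding 0 to the
    set where the cutoff vanishes makes the averaged function compactly supported once pulled back
    to M. *)

Lemma open_near (T : topologicalType) (U : set T) x : open U -> U x ->
  \forall y \near x, U y.
Proof. by move=> oU Ux; apply: open_nbhs_nbhs. Qed.

Section SmoothCalculus.
Context {R : realType} {n : nat}.
Implicit Types (U V : set 'rV[R]_n) (f g : 'rV[R]_n -> R) (k : nat).

Lemma Ck_on_sub k U V f : U `<=` V -> Ck_on k V f -> Ck_on k U f.
Proof.
elim: k f => [|k IH] f UV /=; first by move=> fV x /UV; exact: fV.
by move=> [df pf]; split=> [x /UV|i]; [exact: df|exact: IH].
Qed.

(** Partial derivatives are taken in the whole space, so [Ck_on k [set x]] is a condition on the
    germ of f at x. Smoothness can thus be checked with a different local expression at each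
    point. *)
Lemma Ck_on_pointwise k U f :
  (forall x, U x -> Ck_on k [set x] f) -> Ck_on k U f.
Proof.
elim: k f => [|k IH] f /= fU; first by move=> x /fU /(_ x erefl).
split=> [x /fU[/(_ x erefl)]//|i].
by apply: IH => x /fU[_]; exact.
Qed.

Lemma Ck_on_near k x f g : (\forall y \near x, f y = g y) ->
  Ck_on k [set x] f -> Ck_on k [set x] g.
Proof.
elim: k f g => [|k IH] f g fg /=.
  move=> /(_ x erefl) cf _ ->.
  have gx : g x = f x by rewrite (nbhs_singleton fg).
  rewrite /prop_for /continuous_at gx.
  exact: (cvg_trans (near_eq_cvg fg) cf).
move=> [df pf]; split=> [_ ->|i].
  by have [] := near_eq_diff fg (df x erefl).
(* [near_join] makes f and g agree near every y close to x, so their partial derivatives agree near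
   x. *)
apply: IH (pf i); apply: filterS (near_join fg) => y fgy.
exact: near_eq_derive.
Qed.

Lemma Ck_on_eq k U f g : open U -> (forall x, U x -> f x = g x) ->
  Ck_on k U f -> Ck_on k U g.
Proof.
move=> oU fg fU; apply: Ck_on_pointwise => x Ux.
apply: (@Ck_on_near k x f g); last by apply: Ck_on_sub fU => _ ->.
by apply: filterS (open_near oU Ux) => y /fg.
Qed.

Lemma Ck_onS k U f : Ck_on k.+1 U f -> Ck_on k U f.
Proof.
elim: k f => [|k IH] f /= [df pf].
  by move=> x /df; exact: differentiable_continuous.
by split=> // i; exact: IH.
Qed.

Lemma Ck_on_cst k U (c : R) : Ck_on k U (fun=> c).
Proof.
elim: k c => [|k IH] c /=; first by move=> x _; exact: cst_continuous.
split=> [x _|i]; first exact: differentiable_cst.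
rewrite (_ : partial i _ = fun=> 0)//.
by apply/funext => x; rewrite /partial derive_cst.
Qed.

Lemma derive_coord (l : 'I_n) (x v : 'rV[R]_n) :
  'D_v (fun y : 'rV[R]_n => y 0 l) x = v 0 l.
Proof.
have /derive_mx : derivable (fun y : 'rV[R]_n => y) x v by exact: derivable_id.
by rewrite derive_id => /matrixP /(_ 0 l); rewrite mxE.
Qed.

Lemma Ck_on_coord k U (l : 'I_n) : Ck_on k U (fun x => x 0 l).
Proof.
case: k => [|k] /=; first by move=> x _; exact: coord_continuous.
split=> [x _|i]; first exact: differentiable_coord.
rewrite (_ : partial i _ = fun=> (delta_mx 0 i : 'rV[R]_n) 0 l).
  exact: Ck_on_cst.
by apply/funext => x; rewrite /partial derive_coord.
Qed.

Lemma Ck_onD k U f g : open U -> Ck_on k U f -> Ck_on k U g ->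
  Ck_on k U (fun x => f x + g x).
Proof.
move=> oU; elim: k f g => [|k IH] f g /=.
  by move=> cf cg x Ux; apply: continuousD; [exact: cf|exact: cg].
move=> [df pf] [dg pg]; split=> [x Ux|i].
  by apply: differentiableD; [exact: df|exact: dg].
apply: (Ck_on_eq oU) (IH _ _ (pf i) (pg i)) => x Ux;
  rewrite /partial -deriveD//.
  by apply: diff_derivable; exact: df.
by apply: diff_derivable; exact: dg.
Qed.

Lemma Ck_onM k U f g : open U -> Ck_on k U f -> Ck_on k U g ->
  Ck_on k U (fun x => f x * g x).
Proof.
move=> oU; elim: k f g => [|k IH] f g.
  by move=> cf cg x Ux; apply: continuousM; [exact: cf|exact: cg].
move=> Cf Cg; have [df pf] := Cf; have [dg pg] := Cg; split=> [x Ux|i].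
  by apply: differentiableM; [exact: df|exact: dg].
have := Ck_onD oU (IH _ _ (Ck_onS Cf) (pg i)) (IH _ _ (Ck_onS Cg) (pf i)).
apply: (Ck_on_eq oU) => x Ux; rewrite /partial.
by rewrite -deriveM//; apply: diff_derivable; [exact: df|exact: dg].
Qed.

Lemma Ck_on_sum (I : Type) (r : seq I) (P : pred I) k U (F : I ->
  'rV[R]_n -> R) :
  open U -> (forall i, P i -> Ck_on k U (F i)) ->
  Ck_on k U (fun x => \sum_(i <- r | P i) F i x).
Proof.
move=> oU FU; elim: r => [|i r IH].
  by apply: (Ck_on_eq oU) (Ck_on_cst k U 0) => x _; rewrite big_nil.
case: (boolP (P i)) => Pi; last first.
  by apply: (Ck_on_eq oU) IH => x _; rewrite big_cons (negbTE Pi).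
by apply: (Ck_on_eq oU) (Ck_onD oU (FU _ Pi) IH) => x _; rewrite big_cons Pi.
Qed.

Lemma Ck_on_prod (I : Type) (r : seq I) (P : pred I) k U (F : I ->
  'rV[R]_n -> R) :
  open U -> (forall i, P i -> Ck_on k U (F i)) ->
  Ck_on k U (fun x => \prod_(i <- r | P i) F i x).
Proof.
move=> oU FU; elim: r => [|i r IH].
  by apply: (Ck_on_eq oU) (Ck_on_cst k U 1) => x _; rewrite big_nil.
case: (boolP (P i)) => Pi; last first.
  by apply: (Ck_on_eq oU) IH => x _; rewrite big_cons (negbTE Pi).
by apply: (Ck_on_eq oU) (Ck_onM oU (FU _ Pi) IH) => x _; rewrite big_cons Pi.
Qed.

(* [s] lists the successive derivatives of [s 0] on [D]. *)
Lemma Ck_on_comp1 k U (D : set R) (s : nat -> R -> R) g : open U ->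
  (forall j x, D x -> is_derive x (1 : R) (s j) (s j.+1 x)) ->
  (forall x, U x -> D (g x)) -> Ck_on k U g -> Ck_on k U (s 0%N \o g).
Proof.
move=> oU ds gD; elim: k s ds => [|k IH] s ds.
  move=> cg x Ux; apply: continuous_comp; first exact: cg.
  apply: differentiable_continuous; apply/derivable1_diffP.
  by have [] := ds 0%N _ (gD _ Ux).
move=> Cg; have [dg pg] := Cg.
have dsx x : U x -> differentiable (s 0%N) (g x).
  by move=> Ux; apply/derivable1_diffP; have [] := ds 0%N _ (gD _ Ux).
split=> [x Ux|i].
  by apply: differentiable_comp; [exact: dg|exact: dsx].
have ds' : forall j x, D x -> is_derive x (1 : R) (s j.+1) (s j.+2 x).
  by move=> j x; exact: ds.
have := Ck_onM oU (IH _ ds' (Ck_onS Cg)) (pg i).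
apply: (Ck_on_eq oU) => x Ux; rewrite /partial.
rewrite [in RHS](deriveE _ (differentiable_comp (dg x Ux) (dsx x Ux))).
rewrite (diff_comp (dg x Ux) (dsx x Ux)) /=.
rewrite deriv1E; last by apply/derivable1_diffP; exact: dsx.
have [_ <-] := ds 0%N _ (gD _ Ux).
by rewrite derive1E (deriveE _ (dg x Ux)) mulrC.
Qed.

End SmoothCalculus.

Lemma coord_diff (R : realType) (m n : nat) (g : 'rV[R]_n -> 'rV[R]_m) x v l :
  differentiable g x -> ('d g x v) 0 l = 'D_v (fun y => g y 0 l) x.
Proof.
move=> dg; rewrite -deriveE// derive_mx ?mxE//.
exact: diff_derivable.
Qed.

Lemma continuous_row (R : realType) (T : topologicalType) (m : nat)
    (g : T -> 'rV[R]_m) x :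
  (forall l, {for x, continuous (fun y => g y 0 l)}) -> {for x, continuous g}.
Proof.
move=> cg; apply/cvgrPdist_lt => e e0.
have : \forall y \near x, forall l, `|g x 0 l - g y 0 l| < e.
  by apply: filter_forall => l; have /cvgrPdist_lt/(_ _ e0) := cg l.
apply: filterS => y gy; rewrite /Num.norm /= mx_normrE.
by apply: bigmax_lt => // -[i j] _ /=; rewrite !mxE (ord1 i).
Qed.

(** Chain rule in coordinates: a partial derivative of the composite is a sum of products of a
    partial derivative of g with [partial l f \o g], to which the induction hypothesis applies. *)
Lemma Ck_on_comp (R : realType) (m n : nat) k (U : set 'rV[R]_n)
    (V : set 'rV[R]_m) (f : 'rV[R]_m -> R) (g : 'rV[R]_n -> 'rV[R]_m) :
  open U -> (forall x, U x -> V (g x)) -> Ck_on k V f ->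
  (forall l, Ck_on k U (fun x => g x 0 l)) -> Ck_on k U (f \o g).
Proof.
move=> oU UV; elim: k f => [|k IH] f.
  move=> cf cg x Ux; apply: continuous_comp; last exact/cf/UV.
  by apply: continuous_row => l; exact: cg.
move=> [df pf] Cg.
have dg x : U x -> differentiable g x.
  by move=> Ux; apply: differentiable_row => l; have [+ _] := Cg l; exact.
split=> [x Ux|i].
  by apply: differentiable_comp; [exact: dg|exact/df/UV].
have : Ck_on k U (fun x =>
    \sum_l partial i (fun x => g x 0 l) x * partial l f (g x)).
  apply: Ck_on_sum => // l _; apply: Ck_onM => //; first exact: (Cg l).2.
  by apply: IH => [|l']; [exact: pf|exact: Ck_onS].
apply: (Ck_on_eq oU) => x Ux; rewrite /partial deriveE; last first.
  by apply: differentiable_comp; [exact: dg|exact/df/UV].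
rewrite diff_comp; [|exact: dg|exact/df/UV].
rewrite /= diff_partialE; last exact/df/UV.
by apply: eq_bigr => l _; rewrite coord_diff//; exact: dg.
Qed.

(** * Smooth step function *)

(** Derivatives at the origin of flat functions, and of limits of Picard iterates, come with an
    explicit quadratic remainder rather than with a limit of difference quotients. *)
Lemma is_derive_quadratic (R : realType) (V : normedModType R) (f : R -> V)
    (x C : R) (d : V) :
  (\forall h \near 0, `|f (x + h) - f x - h *: d| <= C * h ^+ 2) ->
  is_derive x (1 : R) f d.
Proof.
move=> fC.
have cf : h^-1 *: ((f \o shift x) (h *: (1 : R)) - f x) @[h --> 0^'] --> d.
  apply/cvgrPdist_le => e e0.
  have : \forall h \near 0, h != 0 -> `|f (x + h) - f x - h *: d| <= C * h ^+ 2
    /\ `|h| <= e / (`|C| + 1).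
    have e1 : 0 < e / (`|C| + 1) by rewrite divr_gt0// ltr_wpDl.
    near=> h; move=> _; split; first by near: h.
    by near: h; exact: (nbhs0_le (V := R) e1).
  rewrite /dnbhs /= => H; apply: filterS H => h H h0.
  have {H} [H1 H2] := H h0.
  rewrite /= -normrN opprB (_ : _ - d = h^-1 *: (f (x + h) - f x - h *: d));
    last first.
    by rewrite [RHS]scalerBr scalerA mulVf// scale1r [_ *: 1]mulr1 [h + x]addrC.
  rewrite normrZ normfV ler_pdivrMl ?normr_gt0//.
  apply: (le_trans H1); rewrite -real_normK ?num_real// expr2 mulrA.
  rewrite mulrC ler_wpM2l//.
  rewrite (le_trans (ler_wpM2r _ (ler_norm C)))//.
  apply: (@le_trans _ _ ((`|C| + 1) * `|h|));
    first by rewrite ler_wpM2r// lerDl.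
  by rewrite mulrC -ler_pdivlMr// ltr_wpDl.
apply: DeriveDef; first by apply: cvgP cf.
exact: cvg_lim cf.
Unshelve. all: end_near. Qed.

Section FlatFunction.
Context {R : realType}.
Implicit Types (p : {poly R}) (y : R).

(** This is 1 + z <= exp z at z = y / k, raised to the power k. *)
Lemma exp_dominates_monomial k y : 0 <= y -> y ^+ k <= k%:R ^+ k * expR y.
Proof.
move=> y0; case: k => [|k]; first by rewrite !expr0 mul1r -expR0 ler_expR.
have -> : y = k.+1%:R * (y / k.+1%:R) by rewrite mulrCA divff ?mulr1.
rewrite expRM_natl exprMn; apply: ler_wpM2l; first exact: exprn_ge0.
rewrite lerXn2r ?nnegrE ?expR_ge0 ?divr_ge0//.
by apply: le_trans (expR_ge1Dx _); rewrite lerDr.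
Qed.

(** The extra factor y^2 turns into x^2 at y = 1 / x: it is the quadratic vanishing that makes
    [flat p] differentiable at 0. *)
Lemma exp_dominates_poly p : exists C, 0 <= C /\
  forall y, 0 <= y -> `|p.[y]| * y ^+ 2 <= C * expR y.
Proof.
exists (\sum_(i < size p) `|p`_i| * (i + 2)%:R ^+ (i + 2)); split.
  by apply: sumr_ge0 => i _; rewrite mulr_ge0// exprn_ge0.
move=> y y0; rewrite horner_coef mulr_suml.
apply: (@le_trans _ _ ((\sum_(i < size p) `|p`_i| * y ^+ i) * y ^+ 2)).
  rewrite ler_wpM2r ?exprn_ge0//; apply: (le_trans (ler_norm_sum _ _ _)).
  by apply: ler_sum => i _; rewrite normrM normrX (ger0_norm y0).
rewrite mulr_suml; apply: ler_sum => i _.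
by rewrite -!mulrA -exprD ler_wpM2l// exp_dominates_monomial.
Qed.

(** The polynomial factor closes the family under differentiation, so that all derivatives of exp
    (-1/x), which is [flat 1], are treated at once. *)
Definition flat p (x : R) : R := if 0 < x then p.[x^-1] * expR (- x^-1) else 0.

Lemma flat_quadratic p : exists C, 0 <= C /\ forall x,
  `|flat p x| <= C * x ^+ 2.
Proof.
have [C [C0 HC]] := exp_dominates_poly p; exists C; split=> // x; rewrite /flat.
case: ifPn => [x0|_]; last by rewrite normr0 mulr_ge0// sqr_ge0.
have xV : 0 <= x^-1 by rewrite invr_ge0 ltW.
have {HC} := HC _ xV; rewrite exprVn ler_pdivrMr ?exprn_gt0// mulrAC => HC.
rewrite expRN normrM [`|(expR _)^-1|]ger0_norm ?invr_ge0 ?expR_ge0//.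
by rewrite ler_pdivrMr ?expR_gt0.
Qed.

Lemma flat_derive p (x : R) :
  is_derive x (1 : R) (flat p) (flat ('X^2 * (p - p^`())) x).
Proof.
have [x0|x0|->] := ltgtP x 0.
- rewrite /flat ltNge ltW//=.
  have cE : \forall y \near x, (cst 0 : R -> R) y = flat p y.
    near=> y; rewrite /flat ltNge ltW//; near: y; exact: lt_nbhsl.
  exact: near_eq_is_derive cE _.
- have cE : \forall y \near x, (fun y => p.[y^-1] * expR (- y^-1)) y = flat p y.
    near=> y; rewrite /flat ifT//; near: y; exact: lt_nbhsr.
  apply: near_eq_is_derive cE _; rewrite /flat x0.
  have xn0 : x != 0 by rewrite gt_eqF.
  have dV : is_derive x (1 : R) (fun y : R => y^-1) (- x ^- 2).
    by apply: is_derive_eq (is_deriveV xn0 (is_derive_id x 1)) _;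
      rewrite [_ *: _]mulr1.
  have dN : is_derive x (1 : R) (fun y : R => - y^-1) (x ^- 2).
    by apply: is_derive_eq (is_deriveN dV) _; rewrite opprK.
  have dp := is_derive1_comp (is_derive_poly p x^-1) dV.
  have de := is_derive1_comp (g := fun y : R => - y^-1) (is_derive_expR (-
    x^-1)) dN.
  have dpe := is_deriveM dp de.
  apply: is_derive_eq dpe _; rewrite !hornerE /= /GRing.scale /= -exprVn.
  by ring.
- have [C [C0 HC]] := flat_quadratic p.
  apply: (@is_derive_quadratic _ _ _ _ C); near=> h.
  by rewrite /flat ltxx scaler0 add0r !subr0; exact: HC.
Unshelve. all: end_near. Qed.

Lemma smooth_on_flat n (U : set 'rV[R]_n) (g : 'rV[R]_n -> R) : open U ->
  smooth_on U g -> smooth_on U (flat 1 \o g).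
Proof.
move=> oU sg k.
pose s j := flat (iter j (fun p => 'X^2 * (p - p^`())) 1).
by apply: (@Ck_on_comp1 _ _ k U setT s g oU) => // j x _; exact: flat_derive.
Qed.

Lemma smooth_onV n (U : set 'rV[R]_n) (g : 'rV[R]_n -> R) : open U ->
  (forall x, U x -> g x != 0) -> smooth_on U g ->
  smooth_on U (fun x => (g x)^-1).
Proof.
move=> oU g0 sg k.
(* The j-th derivative of 1/x. *)
pose s j (x : R) := (-1) ^+ j * j`!%:R * x ^- j.+1.
have := @Ck_on_comp1 _ _ k U [set x | x != 0] s g oU _ g0 (sg k).
rewrite (_ : s 0%N \o g = fun x => (g x)^-1); last first.
  by apply/funext => x; rewrite /s /= expr0 fact0 !mul1r expr1.
apply=> j x /= x0.
have dX : is_derive x (1 : R) (fun y : R => (y ^+ j.+1)^-1) (- x ^- j.+1 ^+ 2 *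
  (j.+1%:R * x ^+ j)).
  have xj0 : x ^+ j.+1 != 0 by rewrite expf_neq0.
  have dE : is_derive x (1 : R) (fun y : R => y ^+ j.+1) (j.+1%:R * x ^+ j).
    apply: DeriveDef; first exact: exprn_derivable.
    by rewrite exp_derive /GRing.scale /= mulr1.
  have := is_deriveV (f := fun y : R => y ^+ j.+1) xj0 dE.
  by rewrite exprVn.
apply: (is_derive_eq (is_deriveZ ((-1) ^+ j * j`!%:R) dX)); rewrite /s.
have xj : x ^- j.+1 ^+ 2 * x ^+ j = x ^- j.+2.
  by rewrite !exprS expr0; field; rewrite x0 expf_neq0.
rewrite factS natrM [(-1) ^+ j.+1]exprS mulN1r -xj /GRing.scale /=.
by ring.
Qed.

Definition step (x : R) : R := flat 1 x / (flat 1 x + flat 1 (1 - x)).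

Lemma flat1_ge0 (x : R) : 0 <= flat 1 x.
Proof. by rewrite /flat; case: ifP => // _; rewrite hornerC mul1r expR_ge0. Qed.

Lemma flat1_gt0 (x : R) : 0 < x -> 0 < flat 1 x.
Proof. by rewrite /flat => ->; rewrite hornerC mul1r expR_gt0. Qed.

Lemma flat1_eq0 (x : R) : x <= 0 -> flat 1 x = 0.
Proof. by rewrite /flat ltNge => ->. Qed.

(** x and 1 - x are never both nonpositive. *)
Lemma step_den_gt0 (x : R) : 0 < flat 1 x + flat 1 (1 - x).
Proof.
have [x0|x0] := ltP 0 x; first by rewrite ltr_pwDl ?flat1_gt0 ?flat1_ge0.
by rewrite ltr_wpDl ?flat1_ge0// flat1_gt0// subr_gt0 (le_lt_trans x0).
Qed.

Lemma step_ge0 (x : R) : 0 <= step x.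
Proof. by rewrite divr_ge0 ?flat1_ge0// ltW// step_den_gt0. Qed.

Lemma step_le1 (x : R) : step x <= 1.
Proof. by rewrite ler_pdivrMr ?step_den_gt0// mul1r lerDl flat1_ge0. Qed.

Lemma step_eq0 (x : R) : x <= 0 -> step x = 0.
Proof. by move=> x0; rewrite /step flat1_eq0// mul0r. Qed.

Lemma step_eq1 (x : R) : 1 <= x -> step x = 1.
Proof.
move=> x1; rewrite /step (@flat1_eq0 (1 - x)) ?subr_le0// addr0 divff//.
by rewrite gt_eqF// flat1_gt0// (lt_le_trans _ x1).
Qed.

Lemma smooth_on_step n (U : set 'rV[R]_n) (g : 'rV[R]_n -> R) : open U ->
  smooth_on U g -> smooth_on U (step \o g).
Proof.
move=> oU sg.
have sg' : smooth_on U (fun x => 1 - g x).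
  move=> k; have := Ck_onD oU (Ck_on_cst k U 1) (Ck_onM oU (Ck_on_cst k U (-1))
    (sg k)).
  by apply: (Ck_on_eq oU) => x _; rewrite mulN1r.
move=> k; apply: Ck_onM => //; first exact: smooth_on_flat.
apply: smooth_onV => // [x _|k']; first by rewrite gt_eqF// step_den_gt0.
by apply: Ck_onD => //; exact: smooth_on_flat.
Qed.

End FlatFunction.

(** * Compactly supported smooth functions *)

Section SmoothOn.
Context {R : realType} {n : nat}.
Implicit Types (U V : set 'rV[R]_n) (f g : 'rV[R]_n -> R).

Lemma smooth_on_sub U V f : U `<=` V -> smooth_on V f -> smooth_on U f.
Proof. by move=> UV sf k; exact: Ck_on_sub (sf k). Qed.

Lemma smooth_on_pointwise U f :
  (forall x, U x -> smooth_on [set x] f) -> smooth_on U f.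
Proof. by move=> sf k; apply: Ck_on_pointwise => x /sf. Qed.

Lemma smooth_on_near x f g : (\forall y \near x, f y = g y) ->
  smooth_on [set x] f -> smooth_on [set x] g.
Proof. by move=> fg sf k; exact: Ck_on_near (sf k). Qed.

Lemma smooth_on_eq U f g : open U -> (forall x, U x -> f x = g x) ->
  smooth_on U f -> smooth_on U g.
Proof. by move=> oU fg sf k; exact: Ck_on_eq (sf k). Qed.

Lemma smooth_on_cst U (c : R) : smooth_on U (fun=> c).
Proof. by move=> k; exact: Ck_on_cst. Qed.

Lemma smooth_on_coord U l : smooth_on U (fun x => x 0 l).
Proof. by move=> k; exact: Ck_on_coord. Qed.

Lemma smooth_onD U f g : open U -> smooth_on U f -> smooth_on U g ->
  smooth_on U (fun x => f x + g x).
Proof. by move=> oU sf sg k; exact: Ck_onD. Qed.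

Lemma smooth_onM U f g : open U -> smooth_on U f -> smooth_on U g ->
  smooth_on U (fun x => f x * g x).
Proof. by move=> oU sf sg k; exact: Ck_onM. Qed.

Lemma smooth_onN U f : open U -> smooth_on U f -> smooth_on U (fun x => - f x).
Proof.
move=> oU sf; apply: (smooth_on_eq oU) (smooth_onM oU (smooth_on_cst U (-1))
  sf).
by move=> x _; rewrite mulN1r.
Qed.

Lemma smooth_onB U f g : open U -> smooth_on U f -> smooth_on U g ->
  smooth_on U (fun x => f x - g x).
Proof. by move=> oU sf sg; apply: smooth_onD => //; exact: smooth_onN. Qed.

Lemma smooth_on_sum (I : Type) (r : seq I) (P : pred I) U (F : I ->
  'rV[R]_n -> R) :
  open U -> (forall i, P i -> smooth_on U (F i)) ->
  smooth_on U (fun x => \sum_(i <- r | P i) F i x).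
Proof. by move=> oU sF k; apply: Ck_on_sum => // i /sF. Qed.

Lemma smooth_on_prod (I : Type) (r : seq I) (P : pred I) U (F : I ->
  'rV[R]_n -> R) :
  open U -> (forall i, P i -> smooth_on U (F i)) ->
  smooth_on U (fun x => \prod_(i <- r | P i) F i x).
Proof. by move=> oU sF k; apply: Ck_on_prod => // i /sF. Qed.

Lemma smooth_on_partial U f i : smooth_on U f -> smooth_on U (partial i f).
Proof. by move=> sf k; have [_] := sf k.+1; exact. Qed.

Lemma smooth_on_differentiable U f x : smooth_on U f -> U x ->
  differentiable f x.
Proof. by move=> sf Ux; have [+ _] := sf 1%N; exact. Qed.

End SmoothOn.

Lemma smooth_on_comp (R : realType) (m n : nat) (U : set 'rV[R]_n)
    (V : set 'rV[R]_m) (f : 'rV[R]_m -> R) (g : 'rV[R]_n -> 'rV[R]_m) :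
  open U -> (forall x, U x -> V (g x)) -> smooth_on V f ->
  (forall l, smooth_on U (fun x => g x 0 l)) -> smooth_on U (f \o g).
Proof. by move=> oU UV sf sg k; apply: (Ck_on_comp oU UV) => // l;
  exact: sg. Qed.

(** * Max norm of rows and mean value theorems *)

Section VectorCalculus.
Context {R : realType}.

Lemma norm_coord_le (n : nat) (v : 'rV[R]_n) l : `|v 0 l| <= `|v|.
Proof.
rewrite [leRHS]/Num.norm /= mx_normrE.
exact: (@le_bigmax_cond _ _ _ _ (0, l) _ (fun ij => `|v ij.1 ij.2|)).
Qed.

Lemma norm_row_le (n : nat) (v : 'rV[R]_n) (B : R) : 0 <= B ->
  (forall l, `|v 0 l| <= B) -> `|v| <= B.
Proof.
move=> B0 vB; rewrite [leLHS]/Num.norm /= mx_normrE.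
by apply: bigmax_le => // -[i j] _ /=; rewrite (ord1 i).
Qed.

Lemma norm_row_lt (n : nat) (v : 'rV[R]_n) (B : R) : 0 < B ->
  (forall l, `|v 0 l| < B) -> `|v| < B.
Proof.
move=> B0 vB; rewrite [ltLHS]/Num.norm /= mx_normrE.
by apply: bigmax_lt => // -[i j] _ /=; rewrite (ord1 i).
Qed.

Lemma is_derive_comp_diff (V W : normedModType R) (c : R -> V) (F : V -> W)
    (t : R) (v : V) : is_derive t (1 : R) c v -> differentiable F (c t) ->
  is_derive t (1 : R) (F \o c) ('d F (c t) v).
Proof.
move=> dc dF.
have Dc : differentiable c t by apply/derivable1_diffP; exact: ex_derive.
have DFc := differentiable_comp Dc dF.
apply: DeriveDef; first exact/derivable1_diffP.
rewrite deriveE// diff_comp//= deriv1E; last exact: ex_derive.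
by rewrite derive1E derive_val scale1r.
Qed.

Lemma is_derive_line (V : normedModType R) (x w : V) (t : R) :
  is_derive t (1 : R) (fun s : R => x + s *: w) w.
Proof.
apply: (@is_derive_quadratic _ _ _ _ 0); near=> h.
by rewrite mul0r scalerDl addrA [x + _ + _ - _]addrAC subrr add0r subrr normr0.
Unshelve. all: end_near. Qed.

Lemma is_derive_continuous (V : normedModType R) (c : R -> V) (t : R) (v : V) :
  is_derive t (1 : R) c v -> {for t, continuous c}.
Proof.
move=> dc; apply: differentiable_continuous.
by apply/derivable1_diffP; exact: ex_derive.
Qed.

Lemma mean_value_R (f df : R -> R) (a b : R) :
  (forall x, is_derive x (1 : R) f (df x)) ->
  exists2 c, (c - a) * (c - b) <= 0 & f b - f a = df c * (b - a).
Proof.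
move=> dff.
have cf A : {within A, continuous f}.
  by apply: continuous_subspaceT => x; exact: is_derive_continuous (dff x).
have [ab|/ltW ba] := leP a b.
  have [c + fE] := MVT_segment ab (fun x _ => dff x) (cf _).
  rewrite in_itv /= => /andP[ac cb]; exists c => //.
  by rewrite mulr_ge0_le0// ?subr_ge0 ?subr_le0.
have [c + fE] := MVT_segment ba (fun x _ => dff x) (cf _).
rewrite in_itv /= => /andP[bc ca]; exists c.
  by rewrite mulr_le0_ge0// ?subr_ge0 ?subr_le0.
by rewrite -opprB fE -mulrN opprB.
Qed.

Lemma mean_value_line (V : normedModType R) (f : V -> R) (x w : V) :
  (forall y, differentiable f y) ->
  exists2 z, `|z - x| <= `|w| & f (x + w) - f x = 'd f z w.
Proof.
move=> df.
have dg s : is_derive s (1 : R) (f \o (fun s : R => x + s *: w)) ('d f (x + s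
  *: w) w).
  by apply: is_derive_comp_diff; [exact: is_derive_line|exact: df].
have [t t01] := mean_value_R 0 1 dg.
rewrite /= scale1r scale0r addr0 subr0 mulr1 => fE; exists (x + t *: w) => //.
rewrite addrC addKr normrZ ler_piMl// ler_norml.
by apply/andP; nra.
Qed.

End VectorCalculus.

Section CompactlySupported.
Context {R : realType} {n : nat}.
Implicit Types (f g : 'rV[R]_n -> R) (x y w : 'rV[R]_n).

Definition csmooth f := smooth_on setT f /\
  exists r : R, forall x, f x != 0 -> `|x| <= r.

Lemma csmooth_differentiable f x : csmooth f -> differentiable f x.
Proof. by move=> [sf _]; exact: smooth_on_differentiable sf I. Qed.

Lemma csmooth_bounded f : csmooth f -> exists2 B, 0 <= B & forall x,
  `|f x| <= B.
Proof.
move=> [sf [r fr]].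
pose K := closed_ball (0 : 'rV[R]_n) (`|r| + 1).
have r0 : 0 < `|r| + 1 by rewrite ltr_wpDl.
have cK : compact K.
  apply: bounded_closed_compact; last exact: closed_ball_closed.
  exists (`|r| + 1); split; first exact: num_real.
  move=> M rM x; rewrite /K closed_ballE// /closed_ball_ /= sub0r normrN => xr.
  exact: le_trans xr (ltW rM).
have K0 : K !=set0 by exists 0; exact: closed_ballxx.
have cf : {within K, continuous (fun x => `|f x|)}.
  apply: continuous_subspaceT => x; apply: continuous_comp;
    last exact: norm_continuous.
  by apply: differentiable_continuous; exact: smooth_on_differentiable sf I.
have [c _ fc] := EVT_max_rV K0 cK cf.
exists `|f c| => // x; have [->|fx0] := eqVneq (f x) 0; first by rewrite normr0.
apply: fc; rewrite inE /K closed_ballE// /closed_ball_ /= sub0r normrN.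
by rewrite (le_trans (fr _ fx0))// (le_trans (ler_norm r))// lerDl.
Qed.

Lemma csmooth_partial f i : csmooth f -> csmooth (partial i f).
Proof.
move=> [sf [r fr]]; split; first exact: smooth_on_partial.
exists r => x; apply: contraNT; rewrite -ltNge => rx; apply/eqP.
rewrite /partial -(derive_cst (0 : R) x (delta_mx 0 i)); apply: near_eq_derive.
have : \forall y \near x, r < `|y|.
  have := @norm_continuous R _ x; rewrite /continuous_at => /cvgr_gt; exact.
apply: filterS => y ry; apply/eqP; apply: contraTT ry; rewrite -leNgt.
exact: fr.
Qed.

Lemma csmooth_diff_le f : csmooth f ->
  exists2 D, 0 <= D & forall x v, `|'d f x v| <= D * `|v|.
Proof.
move=> sf.
have /choice[B HB] : forall i, exists B, 0 <= B /\ forall x,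
  `|partial i f x| <= B.
  by move=> i; have [B B0 HB] := csmooth_bounded (csmooth_partial i sf);
    exists B.
exists (\sum_i B i); first by apply: sumr_ge0 => i _; have [] := HB i.
move=> x v.
rewrite (diff_partialE v (csmooth_differentiable x sf)).
rewrite mulr_suml (le_trans (ler_norm_sum _ _ _))//; apply: ler_sum => i _.
rewrite normrM mulrC ler_pM//; last exact: norm_coord_le.
by have [_] := HB i; exact.
Qed.

Lemma csmooth_lipschitz f : csmooth f ->
  exists2 L, 0 <= L & forall x y, `|f x - f y| <= L * `|x - y|.
Proof.
move=> sf; have [D D0 fD] := csmooth_diff_le sf; exists D => // x y.
have [z _] := mean_value_line y (x - y) (fun z => csmooth_differentiable z sf).
by rewrite [y + (x - y)]addrC subrK => ->.
Qed.

(** The mean value theorem evaluates the differential at some z with |z - x| <= |w|, and the partial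
    derivatives are Lipschitz. *)
Lemma csmooth_taylor f : csmooth f -> exists2 C, 0 <= C &
  forall x w, `|f (x + w) - f x - 'd f x w| <= C * `|w| ^+ 2.
Proof.
move=> sf.
have /choice[L HL] : forall i, exists L, 0 <= L /\
    forall x y, `|partial i f x - partial i f y| <= L * `|x - y|.
  by move=> i; have [L L0 HL] := csmooth_lipschitz (csmooth_partial i sf);
    exists L.
exists (\sum_i L i); first by apply: sumr_ge0 => i _; have [] := HL i.
move=> x w.
have [z zx ->] := mean_value_line x w (fun z => csmooth_differentiable z sf).
have Ez := diff_partialE w (csmooth_differentiable z sf).
have Ex := diff_partialE w (csmooth_differentiable x sf).
rewrite (congr2 (fun a b => a - b) Ez Ex) -sumrB mulr_suml (le_trans
  (ler_norm_sum _ _ _))//; apply: ler_sum => i _.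
have [L0 Li] := HL i.
rewrite -mulrBr normrM mulrC expr2 mulrA ler_pM//; last exact: norm_coord_le.
by rewrite (le_trans (Li _ _))// ler_wpM2l.
Qed.

Lemma csmooth0 : csmooth (fun=> 0).
Proof.
by split; [exact: smooth_on_cst|exists 0 => x; rewrite eqxx].
Qed.

Lemma csmoothD f g : csmooth f -> csmooth g -> csmooth (fun x => f x + g x).
Proof.
move=> [sf [r fr]] [sg [s gs]]; split; first by apply: smooth_onD => //;
  exact: openT.
exists (Num.max r s) => x; rewrite le_max.
have [->|/fr ->//] := eqVneq (f x) 0; rewrite add0r => /gs ->.
by rewrite orbT.
Qed.

Lemma csmoothMl f g : csmooth f -> smooth_on setT g ->
  csmooth (fun x => f x * g x).
Proof.
move=> [sf [r fr]] sg; split; first by apply: smooth_onM => //; exact: openT.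
by exists r => x; rewrite mulf_eq0 negb_or => /andP[/fr].
Qed.

(** Extension by zero: a point outside U has a neighbourhood that misses the closed set C, where the
    product vanishes. Through it, data known in one chart become functions on the whole Euclidean
    space. *)
Lemma csmooth_cutoff (U C : set 'rV[R]_n) b f : open U -> closed C ->
  C `<=` U ->
  csmooth b -> (forall x, b x != 0 -> C x) -> smooth_on U f ->
  csmooth (fun x => b x * f x).
Proof.
move=> oU cC CU [sb [r br]] bC sf; split; last first.
  by exists r => x; rewrite mulf_eq0 negb_or => /andP[/br].
apply: smooth_on_pointwise => x _; have [Ux|Ux] := pselect (U x).
  have := smooth_onM oU (smooth_on_sub (@subsetT _ U) sb) sf.
  by apply: smooth_on_sub => _ ->.
apply: (@smooth_on_near _ _ x (fun=> 0)); last exact: smooth_on_cst.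
have /open_near/(_ (contra_not (CU x) Ux)) : open (~` C) by rewrite openC.
apply: filterS => y Cy; have [->|/bC//] := eqVneq (b y) 0.
by rewrite mul0r.
Qed.

(** The square stands in for the non-smooth absolute value: step (2 - t^2) is 1 for |t| <= 1 and 0
    once t^2 >= 2. The product over the coordinates matches the max norm. *)
Definition box (a : 'rV[R]_n) (r : R) x : R :=
  \prod_k step (2 - ((x 0 k - a 0 k) / r) ^+ 2).

Lemma box_ge0 a r x : 0 <= box a r x.
Proof. by apply: prodr_ge0 => k _; exact: step_ge0. Qed.

Lemma box_le1 a r x : box a r x <= 1.
Proof. by apply: prodr_ile1 => k _; rewrite step_ge0 step_le1. Qed.

Lemma box_eq1 a r x : 0 < r -> `|x - a| <= r -> box a r x = 1.
Proof.
move=> r0 xa; apply: big1 => k _; apply: step_eq1.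
have xk : `|(x 0 k - a 0 k) / r| <= 1.
  rewrite normrM normfV (gtr0_norm r0) ler_pdivrMr// mul1r.
  by have := norm_coord_le (x - a) k; rewrite !mxE => /le_trans; exact.
have : ((x 0 k - a 0 k) / r) ^+ 2 <= 1.
  by rewrite -real_normK ?num_real// exprn_ile1.
by lra.
Qed.

Lemma box_supp a r x : 0 < r -> box a r x != 0 -> `|x - a| < 2 * r.
Proof.
move=> r0 /prodf_neq0 bx; apply: norm_row_lt => [|k]; first by rewrite mulr_gt0.
rewrite !mxE ltNge; apply: contraNN (bx k isT) => xk; apply/eqP/step_eq0.
have : 2 <= `|(x 0 k - a 0 k) / r|.
  by rewrite normrM normfV (gtr0_norm r0) ler_pdivlMr.
move=> h; rewrite -real_normK ?num_real//.
have : 2 * 2 <= `|(x 0 k - a 0 k) / r| * `|(x 0 k - a 0 k) / r| by rewrite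
  ler_pM.
by rewrite -expr2; lra.
Qed.

Lemma csmooth_box a r : 0 < r -> csmooth (box a r).
Proof.
move=> r0; split.
  apply: smooth_on_prod => [|k _]; first exact: openT.
  apply: smooth_on_step; first exact: openT.
  apply: smooth_onB; [exact: openT|exact: smooth_on_cst|].
  apply: smooth_onM; [exact: openT| |];
    apply: smooth_onM; try exact: openT; try exact: smooth_on_cst;
    apply: smooth_onB; try exact: openT; try exact: smooth_on_cst;
    exact: smooth_on_coord.
exists (`|a| + 2 * r) => x /(box_supp r0)/ltW xa.
by rewrite -(subrK a x) addrC (le_trans (ler_normD _ _))// lerD2l.
Qed.

End CompactlySupported.

(* Near-covering along the filter of sequences ordered by inclusion; the usual
   [compact_cover] would require a pointed space. *)
Lemma compact_seq_cover (T : topologicalType) (K : set T) (U : T -> set T) :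
  compact K -> (forall p, K p -> nbhs p (U p)) ->
  exists s : seq T, forall q, K q -> exists2 p, p \in s & U p q.
Proof.
move=> /compact_near_coveringP cK KU.
pose F := filter_from [set: seq T] (fun s => [set s' : seq T | {subset s <=
  s'}]).
have FF : Filter F.
  apply: filter_from_filter; first by exists [::].
  move=> s s' _ _; exists (s ++ s') => // t st; split=> x xs; apply: st.
    by rewrite mem_cat xs.
  by rewrite mem_cat xs orbT.
have : \forall s \near F, K `<=` [set q | exists2 p, p \in s & U p q].
  apply: cK => p Kp; exists (U p, [set s : seq T | p \in s]).
    split; first exact: KU.
    by exists [:: p] => // s; apply; rewrite inE.
  by move=> [q s] /= [Uq ps]; exists p.
by move=> [s _ sF]; exists s; exact: sF.
Qed.

(** The operation f + g - f g is 1 - (1 - f)(1 - g): it preserves values in [0, 1] and equals 1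
    where either function does. The class S is abstract in order to serve both in Euclidean space
    and on M. *)
Lemma glue_bumps (R : realType) (T : topologicalType) (S : (T -> R) -> Prop)
    (K O : set T) : S (fun=> 0) ->
  (forall f g, S f -> S g -> S (fun x => f x + g x - f x * g x)) ->
  compact K ->
  (forall p, K p -> exists b, [/\ S b, (forall x, 0 <= b x <= 1),
    (forall x, b x != 0 -> O x) & \forall q \near p, b q = 1]) ->
  exists u, [/\ S u, (forall x, 0 <= u x <= 1),
    (forall x, u x != 0 -> O x) & forall x, K x -> u x = 1].
Proof.
move=> S0 SU cK Kb.
have /choice[b Hb] : forall p, exists b : T -> R, K p ->
    [/\ S b, (forall x, 0 <= b x <= 1),
    (forall x, b x != 0 -> O x) & \forall q \near p, b q = 1].
  move=> p; have [/Kb[b Hb]|] := pselect (K p); first by exists b.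
  by exists (fun=> 0).
(* [K p] is recorded in the covering sets because s may contain points outside K, where [b p] is
   unspecified. *)
have [|s Ks] := @compact_seq_cover T K (fun p => [set q | K p /\ b p q = 1]) cK.
  move=> p Kp; have [_ _ _] := Hb p Kp.
  by apply: filterS => q /=.
pose s' := [seq p <- s | `[< K p >]].
have Ks' p : p \in s' -> K p by rewrite mem_filter => /andP[/asboolP].
suff : exists u, [/\ S u, (forall x, 0 <= u x <= 1), (forall x, u x != 0 ->
  O x) &
    forall p x, p \in s' -> b p x = 1 -> u x = 1].
  move=> [u [Su u01 uO us]]; exists u; split=> // x /Ks[p ps [Kp]].
  by apply: us; rewrite mem_filter ps andbT; apply/asboolP.
elim: s' Ks' => [|p s' IH] Ks'.
  by exists (fun=> 0); split=> // x; rewrite ?eqxx// lexx ler01.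
have [|u [Su u01 uO us]] := IH; first by move=> q qs; apply: Ks';
  rewrite inE qs orbT.
have [Sb b01 bO _] := Hb p (Ks' p (mem_head _ _)).
exists (fun x => b p x + u x - b p x * u x); split; first exact: SU.
- move=> x; have /andP[b0 b1] := b01 x; have /andP[u0 u1] := u01 x;
  apply/andP; nra.
- move=> x; have [->|/bO//] := eqVneq (b p x) 0.
  by rewrite add0r mul0r subr0; exact: uO.
- move=> q x; rewrite inE => /orP[/eqP-> ->|/us H /H->];
  first by rewrite mul1r addrK.
  by rewrite mulr1 addrAC subrr add0r.
Qed.

Lemma smooth_urysohn (R : realType) (n : nat) (K O : set 'rV[R]_n) :
  compact K -> open O -> K `<=` O ->
  exists u, [/\ csmooth u, (forall x, 0 <= u x <= 1),
    (forall x, u x != 0 -> O x) & forall x, K x -> u x = 1].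
Proof.
move=> cK oO KO; apply: (glue_bumps _ _ cK); first exact: csmooth0.
  move=> f g sf sg; have := csmoothD (csmoothD sf sg) (csmoothMl (csmoothMl sf
    sg.1) (smooth_on_cst setT (-1))).
  by congr csmooth; apply/funext => x; rewrite mulrN1.
move=> p /KO Op; have /nbhs_ballP[r /= r0 rO] := open_near oO Op.
have r2 : 0 < r / 2 by rewrite divr_gt0.
exists (box p (r / 2)); split; first exact: csmooth_box.
- by move=> x; rewrite box_ge0 box_le1.
- move=> x /(box_supp r2) xp; apply: rO; rewrite -ball_normE /ball_ /= distrC.
  by rewrite (lt_le_trans xp)// mulrCA divff ?mulr1.
- apply: filterS (nbhsx_ballx p (r / 2) r2) => x.
  rewrite -ball_normE /ball_ /= distrC => /ltW; exact: box_eq1.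
Qed.

(** * Curves in Euclidean space *)

Section CurveCalculus.
Context {R : realType}.

Lemma is_derive_row (V : normedModType R) n (F : V -> 'rV[R]_n) (t u : V)
    (v : 'rV[R]_n) :
  (forall l, is_derive t u (fun s => F s 0 l) (v 0 l)) -> is_derive t u F v.
Proof.
move=> dF.
have DF : derivable F t u.
  by apply/derivable_mxP => i l; rewrite (ord1 i); exact: ex_derive.
apply: DeriveDef => //; rewrite derive_mx//; apply/rowP => l; rewrite !mxE.
exact: derive_val.
Qed.

Lemma is_derive_coord (V : normedModType R) n (F : V -> 'rV[R]_n) (t u : V)
    (v : 'rV[R]_n) l : is_derive t u F v ->
      is_derive t u (fun s => F s 0 l) (v 0 l).
Proof.
move=> dF; have DF : derivable F t u by exact: ex_derive.
apply: DeriveDef; first by move/derivable_mxP : DF; exact.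
by rewrite -(@derive_val _ _ _ _ _ _ _ dF) derive_mx// mxE.
Qed.

Lemma is_derive_comp_time (W : normedModType R) (c : R -> R) (F : R -> W)
    (t v : R) (w : W) : is_derive t (1 : R) c v ->
      is_derive (c t) (1 : R) F w ->
  is_derive t (1 : R) (F \o c) (v *: w).
Proof.
move=> dc dF.
have DF : differentiable F (c t) by apply/derivable1_diffP; exact: ex_derive.
apply: is_derive_eq (is_derive_comp_diff dc DF) _.
by rewrite deriv1E ?derive1E ?derive_val//; exact: ex_derive.
Qed.

Lemma is_derive_shift_time (W : normedModType R) (F : R ->
  W) (a t : R) (w : W) :
  is_derive (a + t) (1 : R) F w -> is_derive t (1 : R) (fun s => F (a + s)) w.
Proof.
move=> dF; have da : is_derive t (1 : R) (fun s : R => a + s) 1.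
  apply: is_derive_eq (is_deriveD (is_derive_cst a t 1) (is_derive_id t 1)) _.
  by rewrite add0r.
by have := is_derive_comp_time da dF; rewrite scale1r.
Qed.

Lemma is_derive_reverse (W : normedModType R) (F : R -> W) (t : R) (w : W) :
  is_derive (- t) (1 : R) F w -> is_derive t (1 : R) (fun s => F (- s)) (- w).
Proof.
move=> dF; have da : is_derive t (1 : R) (fun s : R => - s) (-1).
  exact: is_deriveN (is_derive_id t 1).
by have := is_derive_comp_time da dF; rewrite scaleN1r.
Qed.

Lemma derive_ge0_le (g g' : R -> R) (t : R) : 0 <= t ->
  (forall s, 0 <= s <= t -> is_derive s (1 : R) g (g' s)) ->
  (forall s, 0 <= s <= t -> 0 <= g' s) -> g 0 <= g t.
Proof.
move=> t0 dg g0.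
have cg : {within `[0, t], continuous g}.
  by apply: derivable_within_continuous => s; rewrite in_itv /= => /dg.
have [c ct gE] : exists2 c, c \in `[0, t] & g t - g 0 = g' c * (t - 0).
  apply: MVT_segment => // s; rewrite in_itv /= => /andP[s0 st].
  by apply: dg; rewrite !ltW.
rewrite -subr_ge0 gE subr0 mulr_ge0//; apply: g0.
by rewrite in_itv /= in ct.
Qed.

(** On [0, t] each of g + f_l and g - f_l has a nonnegative derivative; negative times follow by
    reversal. The majorant g plays the part of the integral of the bound, so that exponential
    weights can be plugged in directly. *)
Lemma norm_derive_le n (f f' : R -> 'rV[R]_n) (g g' : R -> R) (T t : R) :
  (forall s, `|s| <= T -> is_derive s (1 : R) f (f' s)) ->
  (forall s, 0 <= s <= T -> is_derive s (1 : R) g (g' s)) ->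
  (forall s, `|s| <= T -> `|f' s| <= g' `|s|) ->
  `|t| <= T -> `|f t - f 0| <= g `|t| - g 0.
Proof.
wlog t0 : f f' t / 0 <= t => [H|].
  have [/H|/ltW t0 df dg fg tT] := leP 0 t; first exact.
  have := H (fun s => f (- s)) (fun s => - f' (- s)) (- t).
  rewrite opprK oppr0 normrN oppr_ge0 => /(_ t0); apply=> // s sT.
    by apply: is_derive_reverse; apply: df; rewrite normrN.
  by rewrite normrN -[leRHS](congr1 g' (normrN s)); apply: fg; rewrite normrN.
move=> df dg fg; rewrite (ger0_norm t0) => tT.
have absT s : 0 <= s <= t -> 0 <= s <= T /\ `|s| <= T.
  by move=> /andP[s0 st]; rewrite ger0_norm// s0 (le_trans st).
have fgs s l : 0 <= s <= t -> `|f' s 0 l| <= g' s.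
  move=> st; have [/andP[s0 _] sT] := absT _ st.
  by rewrite -[s in leRHS](ger0_norm s0) (le_trans (norm_coord_le _ _))// fg.
have key l : `|f t 0 l - f 0 0 l| <= g t - g 0.
  rewrite ler_norml; apply/andP; split.
    have : (g \+ (fun s => f s 0 l)) 0 <= (g \+ (fun s => f s 0 l)) t.
      apply: (derive_ge0_le (g' := fun s => g' s + f' s 0 l)) => // s st.
        have [sT sT'] := absT _ st.
        by apply: is_deriveD; [exact: dg|apply: is_derive_coord; exact: df].
      by have := fgs s l st; rewrite ler_norml => /andP[]; lra.
    by rewrite /=; lra.
  have : (g \- (fun s => f s 0 l)) 0 <= (g \- (fun s => f s 0 l)) t.
    apply: (derive_ge0_le (g' := fun s => g' s - f' s 0 l)) => // s st.
      have [sT sT'] := absT _ st.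
      by apply: is_deriveB; [exact: dg|apply: is_derive_coord; exact: df].
    by have := fgs s l st; rewrite ler_norml => /andP[]; lra.
  by rewrite /=; lra.
have g0 : 0 <= g t - g 0.
  rewrite subr_ge0; apply: (@derive_ge0_le _ g') => // s st.
    by have [sT _] := absT _ st; exact: dg.
  have [/andP[s0 _] sT] := absT _ st; rewrite -(ger0_norm s0).
  exact: le_trans (fg _ sT).
by apply: norm_row_le => // l; rewrite !mxE; exact: key.
Qed.

(** The fundamental theorem of calculus gives primitives on bounded intervals; normalised to vanish
    at 0, they agree on overlaps and glue to the line. *)
Lemma antiderivative (f : R -> R) : continuous f ->
  exists F : R -> R, F 0 = 0 /\ forall t, is_derive t (1 : R) F (f t).
Proof.
move=> cf.
have /choice[P HP] (N : R) : exists P : R -> R, 0 < N ->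
    forall x, - N < x < N -> is_derive x (1 : R) P (f x).
  have [N0|N0] := ltP 0 N; last by exists (fun=> 0).
  exists (fun x => \int[lebesgue_measure]_(t in [set` Interval (BLeft (- N))
    (BRight x)]) f t)%R.
  move=> _ x /andP[Nx xN].
  have [||dF] := @continuous_FTC1 R f (BLeft (- N)) x N xN _ _ (cf x).
  - apply: continuous_compact_integrable; first exact: segment_compact.
    exact: continuous_subspaceT.
  - by have := ltW Nx.
  - by rewrite derive1E => FE; exact: (DeriveDef dF FE).
pose Q N x := P N x - P N 0.
have dQ (N x : R) : 0 < N -> - N < x < N -> is_derive x (1 : R) (Q N) (f x).
  move=> N0 xN; apply: is_derive_eq (is_deriveB (HP _ N0 _ xN) (is_derive_cst _
    _ _)) _.
  by rewrite subr0.
have Qeq (M N x : R) : `|x| < M -> `|x| < N -> Q M x = Q N x.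
  move=> xM xN.
  have M0 := le_lt_trans (normr_ge0 x) xM;
    have N0 := le_lt_trans (normr_ge0 x) xN.
  (* The difference of two primitives has derivative 0; the majorant 0 in dimension 1 makes it
     constant. *)
  have H := @norm_derive_le 1 (fun s => const_mx (Q M s - Q N s)) (fun=> 0)
    (fun=> 0) (fun=> 0) `|x| x.
  have : `|(const_mx (Q M x - Q N x) : 'rV[R]_1) - const_mx (Q M 0 - Q N 0)| <=
    0.
    rewrite -[leRHS](subrr (0 : R)); apply: H => // [s sx|s _].
    - apply: is_derive_row => l; rewrite mxE.
      under eq_fun do rewrite mxE.
      rewrite -(subrr (f s)).
      apply: is_deriveB; apply: dQ => //.
        by rewrite -ltr_norml (le_lt_trans sx).
      by rewrite -ltr_norml (le_lt_trans sx).
    - by rewrite normr0.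
  rewrite normr_le0 subr_eq0 => /eqP/matrixP/(_ 0 0);
    rewrite !mxE /Q !subrr => /eqP.
  by rewrite subr_eq0 => /eqP.
exists (fun x => Q (`|x| + 1) x); split; first by rewrite /Q subrr.
(* The interval index |x| + 1 varies with x; near t it may be frozen at |t| + 2, which still exceeds
   |x|. *)
move=> t; have N0 : 0 < `|t| + 2 by rewrite ltr_wpDl.
apply: near_eq_is_derive (dQ (`|t| + 2) t N0 _); last first.
  by rewrite -ltr_norml ltrDl.
near=> x; apply: Qeq; last by rewrite ltrDl.
have : `|t - x| < 2 by near: x; exact: cvgr_dist_lt.
move=> tx; rewrite -{1}(subrK t x) (le_lt_trans (ler_normD _ _))//.
by rewrite addrC ltrD2l distrC.
Unshelve. all: end_near. Qed.

Lemma antiderivative_row n (f : R -> 'rV[R]_n) : continuous f ->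
  exists F : R -> 'rV[R]_n, F 0 = 0 /\ forall t, is_derive t (1 : R) F (f t).
Proof.
move=> cf.
have /choice[F HF] (l : 'I_n) : exists F : R -> R, F 0 = 0 /\
    forall t, is_derive t (1 : R) F (f t 0 l).
  apply: antiderivative => t; apply: (@continuous_comp _ _ _ f (fun v => v 0
    l)).
    exact: cf.
  exact: coord_continuous.
exists (fun t => \row_l F l t); split.
  by apply/rowP => l; rewrite !mxE; have [] := HF l.
move=> t; apply: is_derive_row => l; under eq_fun do rewrite mxE.
by have [_] := HF l; exact.
Qed.

Lemma geometric_small (C e : R) : 0 < e -> exists k : nat, C * 2^-1 ^+ k <= e.
Proof.
move=> e0; have q1 : `|2^-1 : R| < 1 by rewrite gtr0_norm ?invf_lt1 ?ltr1n.
have /cvgr_dist_le/(_ _ e0) := cvg_geometric C q1.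
move=> [k _ /(_ k (leqnn _))] /= ; rewrite sub0r normrN => H; exists k.
exact: le_trans (ler_norm _) H.
Qed.

Lemma le_geometric (a b C : R) : (forall k : nat, a <= b + C * 2^-1 ^+ k) ->
  a <= b.
Proof.
move=> abC; apply/ler_addgt0Pr => e /(geometric_small C)[k Ck].
by apply: le_trans (abC k) _; rewrite lerD2l.
Qed.

Lemma geometric_limit (u : nat -> R) (D : R) :
  (forall k, `|u k.+1 - u k| <= D * 2^-1 ^+ k) ->
  exists l, forall k, `|u k - l| <= 2 * D * 2^-1 ^+ k.
Proof.
move=> uD.
have q1 : `|2^-1 : R| < 1 by rewrite gtr0_norm ?invf_lt1 ?ltr1n.
have cu : cvgn (series (fun k => u k.+1 - u k)).
  apply: normed_cvg; apply: series_le_cvg (is_cvg_geometric_series (a := D) q1)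
    => k /=.
  - exact: normr_ge0.
  - exact: le_trans (normr_ge0 _) (uD k).
  - exact: uD.
pose l := u 0%N + limn (series (fun k => u k.+1 - u k)).
have ul : u k @[k --> \oo] --> l.
  have cu0 : cst (u 0%N) k @[k --> \oo] --> u 0%N by exact: cvg_cst.
  apply: cvg_trans (cvgD cu0 cu); apply: near_eq_cvg; near=> k => /=.
  by rewrite /= fctE /series /= telescope_sumr// addrC subrK.
exists l => k.
(* The right-hand side is the sum of the m terms D 2^-j starting at j = k. *)
have H m : `|u (k + m)%N - u k| <= 2 * D * 2^-1 ^+ k * (1 - 2^-1 ^+ m).
  elim: m => [|m IH]; first by rewrite addn0 !subrr normr0 mulr0.
  rewrite addnS -(subrK (u (k + m)%N) (u _.+1)) -addrA (le_trans (ler_normD _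
    _))//.
  apply: (le_trans (lerD (uD _) IH)).
  rewrite exprD exprS.
  set a := 2^-1 ^+ k; set b := 2^-1 ^+ m.
  by rewrite (_ : _ + _ = 2 * D * a * (1 - 2^-1 * b))//; field.
have D0 : 0 <= D by have := le_trans (normr_ge0 _) (uD 0%N);
  rewrite expr0 mulr1.
apply/ler_addgt0Pr => e e0.
have /cvgr_dist_le/(_ _ e0)[m _ /(_ (k + m)%N (leq_addl _ _)) /= ml] := ul.
rewrite -(subrK (u (k + m)%N) (u k)) -addrA (le_trans (ler_normD _ _))//.
apply: lerD; last by rewrite distrC.
rewrite distrC (le_trans (H m))// ler_piMr//.
by rewrite !mulr_ge0// exprn_ge0.
Unshelve. all: end_near. Qed.

Lemma geometric_limit_row n (u : nat -> 'rV[R]_n) (D : R) :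
  (forall k, `|u k.+1 - u k| <= D * 2^-1 ^+ k) ->
  exists l, forall k, `|u k - l| <= 2 * D * 2^-1 ^+ k.
Proof.
move=> uD.
have /choice[l Hl] i : exists l : R, forall k,
  `|u k 0 i - l| <= 2 * D * 2^-1 ^+ k.
  apply: geometric_limit => k; apply: le_trans (uD k).
  by have := norm_coord_le (u k.+1 - u k) i; rewrite !mxE.
have D0 : 0 <= D by have := le_trans (normr_ge0 _) (uD 0%N);
  rewrite expr0 mulr1.
exists (\row_i l i) => k; apply: norm_row_le => [|i].
  by rewrite !mulr_ge0// exprn_ge0.
by rewrite !mxE; exact: Hl.
Qed.

End CurveCalculus.

(** * Flow of a Lipschitz vector field *)

Lemma lipschitz_continuous (R : realType) (U W : normedModType R) (L : R)
    (V : U -> W) : (forall x y, `|V x - V y| <= L * `|x - y|) -> continuous V.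
Proof.
move=> VL x; apply/cvgrPdist_le => e e0; near=> y.
apply: le_trans (VL _ _) _.
apply: (@le_trans _ _ ((`|L| + 1) * `|x - y|)).
  by rewrite ler_wpM2r// (le_trans (ler_norm L))// lerDl.
rewrite mulrC -ler_pdivlMr ?ltr_wpDl//.
by near: y; apply: cvgr_dist_le => //; rewrite divr_gt0// ltr_wpDl.
Unshelve. all: end_near. Qed.

Section Flow.
Context {R : realType} {n : nat}.
Variables (V : 'rV[R]_n -> 'rV[R]_n) (L B : R).
Hypothesis L_gt0 : 0 < L.
Hypothesis V_lip : forall x y, `|V x - V y| <= L * `|x - y|.
Hypothesis V_bnd : forall x, `|V x| <= B.

(* Measured against exp (2 L |t|) (Bielecki's norm), each Picard step halves the
   distance, so that the iterates converge on the whole line at once. *)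
Definition picard_weight (k : nat) (s : R) : R :=
  B / L * 2^-1 ^+ k * expR (2 * L * s).

Lemma is_derive_weight k s :
  is_derive s (1 : R) (picard_weight k) (2 * L * picard_weight k s).
Proof.
have dl : is_derive s (1 : R) (fun s : R => 2 * L * s) (2 * L).
  apply: is_derive_eq (is_deriveZ (2 * L) (is_derive_id s 1)) _.
  by rewrite /GRing.scale /= mulr1.
have de := is_derive1_comp (is_derive_expR _) dl.
apply: is_derive_eq (is_deriveZ (B / L * 2^-1 ^+ k) de) _.
by rewrite /picard_weight /GRing.scale /=; ring.
Qed.

(** A total choice, so that [picard] is a plain recursion; the continuity that makes the choice
    meaningful is proved afterwards by induction, in [picard_spec]. *)
Definition antideriv (c : R -> 'rV[R]_n) : R -> 'rV[R]_n :=
  xget (cst 0) [set F | F 0 = 0 /\ forall t, is_derive t (1 : R) F (c t)].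

Lemma antiderivP c : continuous c ->
  antideriv c 0 = 0 /\ forall t, is_derive t (1 : R) (antideriv c) (c t).
Proof.
move=> cc; have [F HF] := antiderivative_row cc.
rewrite /antideriv; by case: xgetP => [G _ //|/(_ F)].
Qed.

Definition picard (y : 'rV[R]_n) : nat -> R -> 'rV[R]_n :=
  fix picard k := if k is k'.+1 then fun t => y + antideriv (V \o picard k') t
                  else fun=> y.

Lemma picard_spec y k : continuous (picard y k) /\
  forall t, is_derive t (1 : R) (picard y k.+1) (V (picard y k t)).
Proof.
elim: k => [|k [IHc IHd]].
  have c0 : continuous (picard y 0) by move=> t; exact: cst_continuous.
  split=> // t.
  have cV : continuous (V \o picard y 0) by move=> s; exact: cst_continuous.
  have [_ dV] := antiderivP cV.
  apply: is_derive_eq (is_deriveD (is_derive_cst y t 1) (dV t)) _.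
  by rewrite add0r.
have ck : continuous (picard y k.+1) by move=> t;
  exact: is_derive_continuous (IHd t).
split=> // t.
have cV : continuous (V \o picard y k.+1).
  by move=> s; apply: continuous_comp; [exact: ck|exact: (lipschitz_continuous
    V_lip)].
have [_ dV] := antiderivP cV.
apply: is_derive_eq (is_deriveD (is_derive_cst y t 1) (dV t)) _.
by rewrite add0r.
Qed.

Lemma picard_at0 y k : picard y k 0 = y.
Proof.
case: k => [//|k] /=.
have cV : continuous (V \o picard y k).
  by move=> s; apply: continuous_comp; [exact: (picard_spec y k).1|exact:
    (lipschitz_continuous V_lip)].
by have [-> _] := antiderivP cV; rewrite addr0.
Qed.

Lemma bound_ge0 : 0 <= B.
Proof. exact: le_trans (normr_ge0 _) (V_bnd 0). Qed.

(** L times the weight of index k is the derivative of the weight of index k + 1, so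
    [norm_derive_le] carries the Lipschitz bound one step further. The factor B / L of the weight
    covers the first step. *)
Lemma picard_step y k t : `|picard y k.+1 t - picard y k t| <= picard_weight k
  `|t|.
Proof.
have B0 := bound_ge0; elim: k t => [|k IH] t.
  have := @norm_derive_le _ _ (picard y 1) (fun s => V (picard y 0 s))
    (picard_weight 0)
    (fun s => 2 * L * picard_weight 0 s) `|t| t (fun s _ => (picard_spec y 0).2
      s)
    (fun s _ => is_derive_weight 0 s).
  rewrite picard_at0 => H; apply: le_trans (H _ _) _ => // [s _|].
    apply: le_trans (V_bnd _) _; rewrite /picard_weight expr0 mulr1.
    rewrite (_ : 2 * L * (B / L * expR (2 * L * `|s|)) = 2 * (B * expR (2 * L *
      `|s|))); last first.
      by field; rewrite gt_eqF.
    have : 1 <= expR (2 * L * `|s|).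
      by rewrite -expR0 ler_expR !mulr_ge0// ltW.
    by move=> e1; have := bound_ge0; nra.
  by rewrite lerBlDr lerDl /picard_weight !mulr_ge0 ?invr_ge0 ?exprn_ge0
    ?expR_ge0// ltW.
have := @norm_derive_le _ _ (fun s => picard y k.+2 s - picard y k.+1 s)
  (fun s => V (picard y k.+1 s) - V (picard y k s)) (picard_weight k.+1)
  (fun s => 2 * L * picard_weight k.+1 s) `|t| t
  (fun s _ => is_deriveB ((picard_spec y k.+1).2 s) ((picard_spec y k).2 s))
  (fun s _ => is_derive_weight k.+1 s).
rewrite !picard_at0 subrr subr0 => H; apply: le_trans (H _ _) _ => // [s _|].
  apply: le_trans (V_lip _ _) _; apply: le_trans (ler_wpM2l (ltW L_gt0) (IH s))
    _.
  rewrite le_eqVlt; apply/orP; left; apply/eqP; rewrite /picard_weight exprS.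
  by field; rewrite gt_eqF.
by rewrite lerBlDr lerDl /picard_weight !mulr_ge0 ?invr_ge0 ?exprn_ge0
  ?expR_ge0// ltW.
Qed.

Lemma picard_lip y k t s : `|picard y k (t + s) - picard y k t| <= B * `|s|.
Proof.
have B0 := bound_ge0; case: k => [|k]; first by rewrite subrr normr0 mulr_ge0.
have dg (r : R) : is_derive r (1 : R) (fun r : R => B * r) B.
  apply: is_derive_eq (is_deriveZ B (is_derive_id r 1)) _.
  by rewrite /GRing.scale /= mulr1.
have := @norm_derive_le _ _ (fun s => picard y k.+1 (t + s))
  (fun s => V (picard y k (t + s))) (fun r => B * r) (fun=> B) `|s| s
  (fun s _ => is_derive_shift_time ((picard_spec y k).2 (t + s))) (fun s _ =>
    dg s).
by rewrite addr0 mulr0 subr0; apply.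
Qed.

(** Rather than exchanging limit and derivative, the quadratic remainder L B h^2 is proved for the
    k-th iterate up to an error of order 2^-k, which [le_geometric] then removes. *)
Lemma flow_exists : exists theta : R -> 'rV[R]_n -> 'rV[R]_n,
  (forall y, theta 0 y = y) /\
  forall y (t : R), is_derive t (1 : R) (fun s => theta s y) (V (theta t y)).
Proof.
have /choice[c Hc] (y : 'rV[R]_n) : exists c : R -> 'rV[R]_n, forall t k,
    `|picard y k t - c t| <= 2 * picard_weight k `|t|.
  have /choice[c Hc] t : exists l : 'rV[R]_n, forall k, `|picard y k t - l| <=
      2 * (B / L * expR (2 * L * `|t|)) * 2^-1 ^+ k.
    apply: geometric_limit_row => k; apply: le_trans (picard_step y k t) _.
    by rewrite /picard_weight mulrAC.
  exists c => t k; apply: le_trans (Hc t k) _.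
  by rewrite /picard_weight -!mulrA [expR _ * _]mulrC.
exists (fun t y => c y t); split.
  move=> y; apply/eqP; rewrite -subr_eq0 -normr_le0.
  apply: (@le_geometric _ _ _ (2 * (B / L * expR (2 * L * `|0|)))) => k.
  rewrite -opprB normrN -{1}(picard_at0 y k) add0r (le_trans (Hc _ _ k))//.
  by rewrite le_eqVlt; apply/orP; left; apply/eqP; rewrite /picard_weight; ring.
have B0 := bound_ge0.
move=> y t; apply: (@is_derive_quadratic _ _ _ _ (L * B)); near=> h.
pose K (t : R) := 2 * (B / L * expR (2 * L * `|t|)).
apply: (@le_geometric _ _ _ (K (t + h) + K t + L * `|h| * K t)) => k.
have KE s : 2 * picard_weight k `|s| = K s * 2^-1 ^+ k by rewrite /K
  /picard_weight; ring.
(* The derivative L (2 B s + K t 2^-k) of this majorant dominates L (B s + K t 2^-k), the bound on V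
   (picard y k (t + s)) - V (c y t) given by the speed B and the distance of the iterate to the
   limit. *)
have dg (s : R) : is_derive s (1 : R) (fun s : R => L * (B * s + K t * 2^-1 ^+
  k) * s)
    (L * (B * s + K t * 2^-1 ^+ k) + L * B * s).
  have d1 : is_derive s (1 : R) (fun s : R => L * (B * s + K t * 2^-1 ^+ k)) (L
    * B).
    have := is_deriveZ L (is_deriveD (is_deriveZ B (is_derive_id s 1))
      (is_derive_cst (K t * 2^-1 ^+ k) s 1)).
    by move=> H; apply: is_derive_eq H _; rewrite /GRing.scale /= mulr1 addr0.
  apply: is_derive_eq (is_deriveM d1 (is_derive_id s 1)) _.
  by rewrite /GRing.scale /=; ring.
have df (s : R) : is_derive s (1 : R) (fun s => picard y k.+1 (t + s) - s *: V
  (c y t))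
    (V (picard y k (t + s)) - V (c y t)).
  apply: is_deriveB; first exact/is_derive_shift_time/(picard_spec y k).2.
  have := is_derive_line (0 : 'rV[R]_n) (V (c y t)) s.
  by under eq_fun do rewrite add0r.
have := @norm_derive_le _ _ _ _ _ _ `|h| h (fun s _ => df s) (fun s _ => dg s).
rewrite addr0 scale0r subr0 mulr0 subr0 lexx => H.
have {}H := H _ isT.
have E : c y (t + h) - c y t - h *: V (c y t) =
   (picard y k.+1 (t + h) - h *: V (c y t) - picard y k.+1 t)
   - (picard y k.+1 (t + h) - c y (t + h)) + (picard y k.+1 t - c y t).
  apply/rowP => l; rewrite !mxE; ring.
rewrite E (le_trans (ler_normD _ _))//.
have B1 := ler_normB (picard y k.+1 (t + h) - h *: V (c y t) - picard y k.+1 t)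
   (picard y k.+1 (t + h) - c y (t + h)).
have B2 := Hc y (t + h) k.+1.
have B3 := Hc y t k.+1.
have hk s : 2 * picard_weight k.+1 `|s| <= K s * 2^-1 ^+ k.
  rewrite -KE ler_pM2l// /picard_weight ler_wpM2r ?expR_ge0// ler_wpM2l//.
    by rewrite divr_ge0// ltW.
  by rewrite exprS ler_piMl// ?exprn_ge0// invf_le1 ?ler1n.
have := hk (t + h); have := hk t.
have hsq : h ^+ 2 = `|h| * `|h| by rewrite -expr2 real_normK ?num_real.
have {}H : `|picard y k.+1 (t + h) - h *: V (c y t) - picard y k.+1 t| <=
    L * (B * `|h| + K t * 2^-1 ^+ k) * `|h|.
  apply: H => s sh; apply: le_trans (V_lip _ _) _.
  rewrite -[leLHS]addr0 lerD//; last by rewrite !mulr_ge0// ltW.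
  rewrite ler_wpM2l ?(ltW L_gt0)//.
  rewrite -(subrK (picard y k t) (picard y k (t + s))) -addrA (le_trans
    (ler_normD _ _))//.
  by rewrite lerD ?picard_lip// -KE.
rewrite hsq.
by move: H B1 B2 B3; lra.
Unshelve. all: end_near. Qed.

Definition integral_curve (T : R) (c : R -> 'rV[R]_n) :=
  forall s, `|s| <= T -> is_derive s (1 : R) c (V (c s)).

(** Gronwall's inequality by bootstrapping: starting from the crude bound M, given by relative speed
    at most 2 B, each pass replaces the constant D by |e 0| + D / 2. The fixed point 2 |e 0| of this
    map is the origin of the factor 2. *)
Lemma flow_stability T c d t : integral_curve T c -> integral_curve T d ->
  `|t| <= T -> `|c t - d t| <= 2 * `|c 0 - d 0| * expR (2 * L * `|t|).
Proof.
have B0 := bound_ge0.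
move=> dc dd tT.
pose e s := c s - d s.
have de s : `|s| <= T -> is_derive s (1 : R) e (V (c s) - V (d s)).
  by move=> sT; apply: is_deriveB; [exact: dc|exact: dd].
pose M := `|e 0| + 2 * B * T.
have T0 : 0 <= T by exact: le_trans tT.
have eM s : `|s| <= T -> `|e s| <= M.
  move=> sT.
  have dg (r : R) : is_derive r (1 : R) (fun r : R => 2 * B * r) (2 * B).
    apply: is_derive_eq (is_deriveZ (2 * B) (is_derive_id r 1)) _.
    by rewrite /GRing.scale /= mulr1.
  have := @norm_derive_le _ _ e _ _ _ T s de (fun s _ => dg s) _ sT.
  rewrite mulr0 subr0 => H.
  rewrite -(subrK (e 0) (e s)) (le_trans (ler_normD _ _))// addrC lerD2l.
  apply: le_trans (H _) _ => [r _|]; last by rewrite ler_wpM2l// mulr_ge0.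
  by rewrite (le_trans (ler_normB _ _))// mulr2n mulrDl mul1r lerD.
have M0 : 0 <= M by rewrite addr_ge0// !mulr_ge0.
have key k s : `|s| <= T -> `|e s| <= (2 * `|e 0| + M * 2^-1 ^+ k) * expR (2 *
  L * `|s|).
  elim: k s => [|k IH] s sT.
    have e1 : 1 <= expR (2 * L * `|s|).
      by rewrite -expR0 ler_expR !mulr_ge0// ltW.
    have : 0 <= 2 * `|e 0| by rewrite mulr_ge0.
    by have := eM _ sT; rewrite expr0 mulr1; nra.
  pose D := 2 * `|e 0| + M * 2^-1 ^+ k.
  have dg (r : R) : is_derive r (1 : R) (fun r : R => D / 2 * expR (2 * L * r))
    (L * (D * expR (2 * L * r))).
    have dl : is_derive r (1 : R) (fun s : R => 2 * L * s) (2 * L).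
      apply: is_derive_eq (is_deriveZ (2 * L) (is_derive_id r 1)) _.
      by rewrite /GRing.scale /= mulr1.
    have dx := is_derive1_comp (is_derive_expR _) dl.
    apply: is_derive_eq (is_deriveZ (D / 2) dx) _.
    by rewrite /GRing.scale /=; field.
  have := @norm_derive_le _ _ e _ _ _ T s de (fun s _ => dg s) _ sT.
  rewrite mulr0 expR0 mulr1 => H.
  rewrite -(subrK (e 0) (e s)) (le_trans (ler_normD _ _))//.
  have {}H : `|e s - e 0| <= D / 2 * expR (2 * L * `|s|) - D / 2.
    apply: H => r rT; apply: le_trans (V_lip _ _) _; rewrite ler_pM2l//.
    exact: IH.
  apply: le_trans (lerD H (lexx _)) _.
  have Mk : 0 <= M * 2^-1 ^+ k by rewrite mulr_ge0// exprn_ge0.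
  have e1 : 1 <= expR (2 * L * `|s|) by rewrite -expR0 ler_expR !mulr_ge0// ltW.
  have e00 : 0 <= `|e 0| by [].
  by rewrite /D exprS; nra.
apply: (@le_geometric _ _ _ (M * expR (2 * L * `|t|))) => k.
by rewrite [_ * expR _ * _]mulrAC -mulrDl; exact: key.
Qed.

Lemma integral_curve_unique T c d t : integral_curve T c ->
  integral_curve T d ->
  c 0 = d 0 -> `|t| <= T -> c t = d t.
Proof.
move=> dc dd cd0 /(flow_stability dc dd); rewrite cd0 subrr normr0 mulr0 mul0r.
by rewrite normr_le0 subr_eq0 => /eqP.
Qed.

End Flow.

(** * Averages along Euler iterates *)

Section VectorField.
Context {R : realType} {n : nat}.
Variable W : 'rV[R]_n -> 'rV[R]_n.
Hypothesis sW : forall l, csmooth (fun y => W y 0 l).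

Lemma field_bounded : exists2 B, 0 <= B & forall x, `|W x| <= B.
Proof.
have /choice[B HB] l : exists B, 0 <= B /\ forall x, `|W x 0 l| <= B.
  by have [B B0 HB] := csmooth_bounded (sW l); exists B.
have B0 l : 0 <= B l by have [] := HB l.
exists (\sum_l B l) => [|x]; first exact: sumr_ge0.
apply: norm_row_le => [|l]; first exact: sumr_ge0.
have [_ /(_ x) /le_trans] := HB l; apply.
by rewrite (bigD1 l)//= lerDl sumr_ge0.
Qed.

Lemma field_lipschitz :
  exists2 L, 0 < L & forall x y, `|W x - W y| <= L * `|x - y|.
Proof.
have /choice[B HB] l : exists B, 0 <= B /\
    forall x y, `|W x 0 l - W y 0 l| <= B * `|x - y|.
  by have [B B0 HB] := csmooth_lipschitz (sW l); exists B.
have B0 l : 0 <= B l by have [] := HB l.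
have S0 : 0 <= \sum_l B l by exact: sumr_ge0.
(* The [+ 1] makes the constant positive: the weights of the Picard iteration divide by it. *)
exists (\sum_l B l + 1) => [|x y]; first by rewrite ltr_wpDl.
apply: norm_row_le => [|l]; first by rewrite mulr_ge0// addr_ge0.
rewrite !mxE; have [_ /(_ x y) /le_trans] := HB l; apply.
rewrite ler_wpM2r// (bigD1 l)//= -addrA lerDl addr_ge0//.
exact: sumr_ge0.
Qed.

Lemma field_differentiable x : differentiable W x.
Proof. by apply: differentiable_row => l; exact: csmooth_differentiable. Qed.

Lemma field_diff_coord x v l : ('d W x v) 0 l = 'd (fun y => W y 0 l) x v.
Proof.
rewrite coord_diff; last exact: field_differentiable.
by rewrite deriveE//; exact: csmooth_differentiable.
Qed.

Lemma field_diff_le : exists2 D, 0 < D & forall x v, `|'d W x v| <= D * `|v|.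
Proof.
have /choice[B HB] l : exists B, 0 <= B /\
    forall x v, `|'d (fun y => W y 0 l) x v| <= B * `|v|.
  by have [B B0 HB] := csmooth_diff_le (sW l); exists B.
have B0 l : 0 <= B l by have [] := HB l.
have S0 : 0 <= \sum_l B l by exact: sumr_ge0.
exists (\sum_l B l + 1) => [|x v]; first by rewrite ltr_wpDl.
apply: norm_row_le => [|l]; first by rewrite mulr_ge0// addr_ge0.
rewrite field_diff_coord; have [_ /(_ x v) /le_trans] := HB l; apply.
rewrite ler_wpM2r// (bigD1 l)//= -addrA lerDl addr_ge0//.
exact: sumr_ge0.
Qed.

Lemma field_taylor : exists2 C, 0 <= C &
  forall x w, `|W (x + w) - W x - 'd W x w| <= C * `|w| ^+ 2.
Proof.
have /choice[B HB] l : exists B, 0 <= B /\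
    forall x w, `|W (x + w) 0 l - W x 0 l - 'd (fun y => W y 0 l) x w| <= B *
      `|w| ^+ 2.
  by have [B B0 HB] := csmooth_taylor (sW l); exists B.
have B0 l : 0 <= B l by have [] := HB l.
have S0 : 0 <= \sum_l B l by exact: sumr_ge0.
exists (\sum_l B l) => // x w.
apply: norm_row_le => [|l]; first by rewrite mulr_ge0// exprn_ge0.
rewrite [X in `|X|]mxE [X in X + _]mxE [X in _ + X]mxE [X in _ + X - _]mxE
  field_diff_coord.
have [_ /(_ x w) /le_trans] := HB l; apply.
by rewrite ler_wpM2r ?exprn_ge0// (bigD1 l)//= lerDl sumr_ge0.
Qed.

End VectorField.

(** * Error estimates for the Euler step *)

Section Euler.
Context {R : realType} {n : nat}.
Variable W : 'rV[R]_n -> 'rV[R]_n.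
Hypothesis sW : forall l, csmooth (fun y => W y 0 l).

Definition euler (h : R) (y : 'rV[R]_n) := y + h *: W y.

Lemma smooth_on_euler_iter h k l :
  smooth_on setT (fun y => iter k (euler h) y 0 l).
Proof.
elim: k l => [|k IH] l; first exact: smooth_on_coord.
have oT : open [set: 'rV[R]_n] by exact: openT.
have := smooth_onD oT (IH l) (smooth_onM oT (smooth_on_cst setT h)
  (@smooth_on_comp _ _ _ setT setT (fun y => W y 0 l) (iter k (euler h)) oT
    (fun _ _ => I) (sW l).1 IH)).
by congr smooth_on; apply/funext => y; rewrite iterS !mxE.
Qed.

Lemma euler_iter_differentiable h k y : differentiable (iter k (euler h)) y.
Proof.
apply: differentiable_row => l.
exact: smooth_on_differentiable (smooth_on_euler_iter h k l) I.
Qed.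

Lemma diff_euler_iterS h k y v : 'd (iter k.+1 (euler h)) y v =
  'd (iter k (euler h)) y v +
  h *: 'd W (iter k (euler h) y) ('d (iter k (euler h)) y v).
Proof.
have dk := euler_iter_differentiable h k y.
have dW := field_differentiable sW (iter k (euler h) y).
have dWk := differentiable_comp dk dW.
have ES : iter k.+1 (euler h) = iter k (euler h) + h *: (W \o iter k (euler h)).
  by apply/funext => z; rewrite iterS.
have E1 := congr1 (@^~ v) (diffD dk (differentiableZ h dWk)).
have E2 := congr1 (@^~ v) (diffZ h dWk).
have E3 := congr1 (@^~ v) (diff_comp dk dW).
apply: etrans (congr1 (fun f => 'd f y v) ES) _.
apply: (etrans E1); apply: (congr1 (fun w => 'd (iter k (euler h)) y v + w)).
by apply: (etrans E2); apply: (congr1 (fun w => h *: w)).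
Qed.

Variable theta : R -> 'rV[R]_n -> 'rV[R]_n.
Hypothesis theta0 : forall y, theta 0 y = y.
Hypothesis theta_derive : forall y (t : R),
  is_derive t (1 : R) (fun s => theta s y) (W (theta t y)).

Lemma flow_add s t y : theta (s + t) y = theta t (theta s y).
Proof.
have [L L0 WL] := field_lipschitz sW.
have [B B0 WB] := field_bounded sW.
apply: (@integral_curve_unique _ _ W L B L0 WL WB `|t| (fun r => theta (s + r)
  y)
  (fun r => theta r (theta s y))) => //.
- move=> r _; exact: is_derive_shift_time.
- by rewrite addr0 theta0.
Qed.

Lemma flow_speed B t y : (forall x, `|W x| <= B) ->
  `|theta t y - y| <= B * `|t|.
Proof.
move=> WB.
have dg (r : R) : is_derive r (1 : R) (fun r : R => B * r) B.
  apply: is_derive_eq (is_deriveZ B (is_derive_id r 1)) _.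
  by rewrite /GRing.scale /= mulr1.
have := @norm_derive_le _ _ (fun s => theta s y)
  (fun s => W (theta s y)) (fun r => B * r) (fun=> B) `|t| t
  (fun s _ => theta_derive y s) (fun s _ => dg s).
by rewrite theta0 mulr0 subr0; apply.
Qed.

Lemma euler_local_error L B h y : 0 <= L -> 
  (forall x y, `|W x - W y| <= L * `|x - y|) -> (forall x, `|W x| <= B) ->
  `|theta h y - euler h y| <= L * B * h ^+ 2.
Proof.
move=> L0 WL WB.
have B0 : 0 <= B by exact: le_trans (WB 0).
have dg (s : R) : is_derive s (1 : R) (fun s : R => L * B * s ^+ 2) (2 * (L * B
  * s)).
  have d2 : is_derive s (1 : R) (fun s : R => s ^+ 2) (2 * s).
    have := is_deriveM (is_derive_id s (1 : R)) (is_derive_id s 1).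
    by move=> H; apply: is_derive_eq H _; rewrite /GRing.scale /=; ring.
  apply: is_derive_eq (is_deriveZ (L * B) d2) _.
  by rewrite /GRing.scale /=; ring.
have df (s : R) : is_derive s (1 : R) (fun s => theta s y - s *: W y)
    (W (theta s y) - W y).
  have dl := is_derive_line (0 : 'rV[R]_n) (W y) s.
  have {}dl : is_derive s (1 : R) (fun s : R => s *: W y) (W y).
    by move: dl; under eq_fun do rewrite add0r.
  exact: (is_deriveB (theta_derive y s) dl).
have := @norm_derive_le _ _ _ _ _ _ `|h| h (fun s _ => df s) (fun s _ => dg s).
rewrite theta0 scale0r subr0 expr0n /= mulr0 subr0 lexx real_normK ?num_real//
  => H.
rewrite /euler opprD addrA [_ - y - _]addrAC.
apply: H => // s _; apply: le_trans (WL _ _) _.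
have := flow_speed s y WB => Hs.
rewrite (le_trans (ler_wpM2l L0 Hs))//.
have : 0 <= L * (B * `|s|) by rewrite !mulr_ge0.
by lra.
Qed.

(** The right-hand side solves the recurrence with equality and starts from 0. *)
Lemma discrete_gronwall (a : nat -> R) (q c : R) : 0 <= q ->
  a 0%N <= 0 -> (forall k, a k.+1 <= (1 + q) * a k + q * c) ->
  forall k, a k <= c * ((1 + q) ^+ k - 1).
Proof.
move=> q0 a0 aS; elim=> [|k IH]; first by rewrite expr0 subrr mulr0.
apply: le_trans (aS k) _.
apply: (@le_trans _ _ ((1 + q) * (c * ((1 + q) ^+ k - 1)) + q * c)).
  by rewrite lerD2r ler_wpM2l// addr_ge0.
by rewrite le_eqVlt exprS; apply/orP; left; apply/eqP; ring.
Qed.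

Lemma discrete_gronwall_exp (a : nat -> R) (L h c tau : R) : 0 <= L -> 0 <= h ->
  0 <= c -> a 0%N <= 0 -> (forall k, a k.+1 <= (1 + L * h) * a k + L * h * c) ->
  forall k, k%:R * h <= tau -> a k <= c * expR (L * tau).
Proof.
move=> L0 h0 c0 a0 aS k kt.
have q0 : 0 <= L * h by rewrite mulr_ge0.
apply: le_trans (discrete_gronwall q0 a0 aS k) _.
rewrite ler_wpM2l//; apply: (@le_trans _ _ ((1 + L * h) ^+ k));
  first by rewrite gerBl.
apply: (@le_trans _ _ (expR (L * h) ^+ k)).
  by rewrite lerXn2r ?nnegrE ?expR_ge0 ?addr_ge0// expR_ge1Dx.
by rewrite -expRM_natl ler_expR mulrCA ler_wpM2l.
Qed.

Lemma euler_error tau : exists2 C, 0 <= C & forall h k y, 0 <= h ->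
  k%:R * h <= tau -> `|iter k (euler h) y - theta (k%:R * h) y| <= C * h.
Proof.
have [L L0 WL] := field_lipschitz sW.
have [B B0 WB] := field_bounded sW.
exists (B * expR (L * tau)) => [|h k y h0 kt];
  first by rewrite mulr_ge0 ?expR_ge0.
rewrite mulrAC.
(* The local error L B h^2 is read as (L h)(B h), so the inhomogeneity is c = B h. *)
apply: (@discrete_gronwall_exp (fun k => `|iter k (euler h) y - theta (k%:R *
  h) y|)
  L h (B * h)) => //; rewrite ?(ltW L0) ?mulr_ge0//.
  by rewrite mul0r theta0 subrr normr0.
move=> j; rewrite iterS -natr1 mulrDl mul1r flow_add.
set z := iter j _ y; set w := theta _ y.
have E : euler h z - theta h w = (z - w) + h *: (W z - W w) - (theta h w -
  euler h w).
  by apply/rowP => l; rewrite !mxE; ring.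
rewrite E (le_trans (ler_normB _ _))// (le_trans (lerD (ler_normD _ _) (lexx
  _)))//.
have H1 := euler_local_error h w (ltW L0) WL WB.
rewrite normrZ (ger0_norm h0).
have H2 := WL z w.
rewrite mulrDl mul1r; apply: lerD.
  by rewrite lerD2l [L * h]mulrC -mulrA ler_wpM2l.
by apply: le_trans H1 _; rewrite le_eqVlt; apply/orP; left; apply/eqP; ring.
Qed.

(* The derivative of the k-th Euler iterate maps W to W, up to O(h): this
   replaces the invariance of a vector field under its own flow. *)
Lemma euler_tangent_error tau : exists2 C, 0 <= C & forall h k y, 0 <= h ->
  k%:R * h <= tau ->
  `|'d (iter k (euler h)) y (W y) - W (iter k (euler h) y)| <= C * h.
Proof.
have [D D0 WD] := field_diff_le sW.
have [B B0 WB] := field_bounded sW.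
have [C C0 WC] := field_taylor sW.
(* The Taylor remainder C (B h)^2 is read as (D h)(C B^2 / D h), the shape expected by
   [discrete_gronwall_exp]. *)
exists (C * B ^+ 2 / D * expR (D * tau)) => [|h k y h0 kt].
  by rewrite !mulr_ge0 ?expR_ge0 ?exprn_ge0 ?invr_ge0 ?(ltW D0).
rewrite mulrAC.
have [a [aE a0 aS]] : exists a : nat -> 'rV[R]_n,
    [/\ forall k, a k = 'd (iter k (euler h)) y (W y), a 0%N = W y &
    forall k, a k.+1 = a k + h *: 'd W (iter k (euler h) y) (a k)].
  exists (fun k => 'd (iter k (euler h)) y (W y)); split=> //.
    exact: (congr1 (@^~ (W y)) (@diff_lin R _ _ idfun y (fun x => cvg_id))).
  by move=> j; exact: diff_euler_iterS.
rewrite -(aE k).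
apply: (@discrete_gronwall_exp (fun k => `|a k - W (iter k (euler h) y)|)
  D h (C * B ^+ 2 / D * h)) => //; rewrite ?(ltW D0)//.
- by rewrite !mulr_ge0 ?expR_ge0 ?exprn_ge0 ?invr_ge0 ?(ltW D0).
- by rewrite a0 subrr normr0.
move=> j; rewrite aS {aE a0 aS}; move: (a j) => {}a.
rewrite iterS; set z := iter j _ y.
(* The linearised step applied to W z is the first-order Taylor expansion of W at z + h W z, so only
   the deviation a - W z and a second-order remainder are left. *)
have E : a + h *: 'd W z a - W (euler h z) =
    (a - W z) + h *: 'd W z (a - W z) - (W (z + h *: W z) - W z - 'd W z (h *:
      W z)).
  rewrite linearB linearZ /= scalerBr; apply/rowP => l; rewrite !mxE; ring.
rewrite E (le_trans (ler_normB _ _))// (le_trans (lerD (ler_normD _ _) (lexx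
  _)))//.
have H1 := WC z (h *: W z).
have H2 := WD z (a - W z).
rewrite [in X in _ + X + _ <= _]normrZ (ger0_norm h0) mulrDl mul1r; apply: lerD.
  by rewrite lerD2l -mulrA mulrCA ler_wpM2l.
apply: le_trans H1 _; rewrite normrZ (ger0_norm h0) exprMn.
have -> : D * h * (C * B ^+ 2 / D * h) = C * (h ^+ 2 * B ^+ 2).
  by field; rewrite gt_eqF.
by rewrite ler_wpM2l// ler_wpM2l ?exprn_ge0// lerXn2r ?nnegrE.
Qed.

(** F is the mean of u over K Euler iterates. Along W, the k-th term of h times the derivative is
    close to u (Y (k+1)) - u (Y k), and the sum telescopes. The value c is read off a tube of width
    e because the iterates only stay close to the orbit. *)
Lemma euler_average (u : 'rV[R]_n -> R) (tau e : R) : csmooth u ->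
  (forall x, 0 <= u x <= 1) -> 0 < tau -> 0 < e ->
  exists F, [/\ smooth_on setT F,
    forall y, `|'d F y (W y)| <= tau^-1 + e &
    forall y c, (forall s z, 0 <= s <= tau -> `|z - theta s y| <= e ->
      u z = c) ->
      F y = c].
Proof.
move=> su u01 tau0 e0.
have [C1 C10 H1] := euler_error tau.
have [C2 C20 H2] := euler_tangent_error tau.
have [B B0 WB] := field_bounded sW.
have [D D0 uD] := csmooth_diff_le su.
have [C C0 uC] := csmooth_taylor su.
(* K > tau A gives h A <= 1, so that both error constants times h stay below e: C1 for the distance
   to the orbit, D C2 + C B^2 for the derivative. *)
pose A : R := (C1 + (D * C2 + C * B ^+ 2)) / e + 1.
have S0 : 0 <= D * C2 + C * B ^+ 2 by rewrite addr_ge0// mulr_ge0// exprn_ge0.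
have A0 : 0 < A by apply: ltr_wpDl => //; apply: divr_ge0 (ltW e0);
  exact: addr_ge0.
pose K := (Num.bound (tau * A)).+1.
have KA : tau * A < K%:R by apply: lt_trans (archi_boundP _) _;
  rewrite ?ltr_nat// mulr_ge0// ltW.
have K0 : 0 < K%:R :> R by rewrite ltr0n.
pose h := tau / K%:R.
have h0 : 0 < h by rewrite divr_gt0.
have Kh : K%:R * h = tau by rewrite /h mulrCA divff ?mulr1// gt_eqF.
have hA : h * A <= 1.
  by rewrite /h mulrAC ler_pdivrMr// mul1r ltW.
have hCe : (C1 + (D * C2 + C * B ^+ 2)) * h <= e.
  have -> : C1 + (D * C2 + C * B ^+ 2) = (A - 1) * e.
    by rewrite /A addrK divfK// gt_eqF.
  have he : 0 <= h * e by rewrite mulr_ge0// ltW.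
  by have := ler_wpM2r (ltW e0) hA; rewrite mul1r; nra.
have hC1 : C1 * h <= e by have := mulr_ge0 S0 (ltW h0); lra.
have hC2 : (D * C2 + C * B ^+ 2) * h <= e by have := mulr_ge0 C10 (ltW h0); lra.
pose F y := K%:R^-1 * \sum_(k < K) u (iter k (euler h) y).
have kK (k : 'I_K) : k%:R * h <= tau.
  by rewrite -Kh ler_pM2r// ler_nat ltnW.
have oT : open [set: 'rV[R]_n] by exact: openT.
have suk k : smooth_on setT (u \o iter k (euler h)).
  apply: (@smooth_on_comp _ _ _ setT setT) => //; first exact: su.1.
  exact: smooth_on_euler_iter.
have sF : smooth_on setT F.
  apply: smooth_onM => //; first exact: smooth_on_cst.
  by apply: smooth_on_sum => // k _; exact: suk.
exists F; split=> //.
- move=> y.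
  pose Y k := iter k (euler h) y.
  pose a k := 'd (iter k (euler h)) y (W y).
  have dF : is_derive y (W y) F (K%:R^-1 * \sum_(k < K) 'd u (Y k) (a k)).
    have -> : F = K%:R^-1 *: \sum_(k < K) (u \o iter k (euler h)).
      by apply/funext => z; rewrite /F fctE fct_sumE.
    apply: is_deriveZ; apply: is_derive_sum => k.
    have dk := euler_iter_differentiable h k y.
    have du := csmooth_differentiable (Y k) su.
    apply: DeriveDef.
      by apply: diff_derivable; exact: differentiable_comp dk du.
    apply: etrans (deriveE _ (differentiable_comp dk du)) _.
    exact: (congr1 (@^~ (W y)) (diff_comp dk du)).
  have DF := smooth_on_differentiable (x := y) sF I.
  rewrite -(deriveE _ DF) derive_val.
  (* D C2 comes from replacing the transported vector a k by W (Y k), and C B^2 from the Taylor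
     remainder of u along one Euler step. *)
  have key (k : 'I_K) : `|h * 'd u (Y k) (a k) - (u (Y k.+1) - u (Y k))| <=
      (D * C2 + C * B ^+ 2) * h * h.
    have T1 := uD (Y k) (a k - W (Y k)).
    have T2 := H2 h k y (ltW h0) (kK k).
    have T3 := uC (Y k) (h *: W (Y k)).
    rewrite linearB /= in T1; rewrite linearZ /= in T3.
    have -> : h * 'd u (Y k) (a k) - (u (Y k.+1) - u (Y k)) =
       h * ('d u (Y k) (a k) - 'd u (Y k) (W (Y k)))
       - (u (Y k + h *: W (Y k)) - u (Y k) - h * 'd u (Y k) (W (Y k))).
      by rewrite /Y iterS; ring.
    rewrite (le_trans (ler_normB _ _))// 2!mulrDl; apply: lerD.
      rewrite normrM (gtr0_norm h0) mulrC ler_wpM2r ?(ltW h0)//.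
      by rewrite (le_trans T1)// -mulrA ler_wpM2l.
    apply: (le_trans T3); rewrite normrZ (gtr0_norm h0) exprMn.
    have -> : C * B ^+ 2 * h * h = C * (h ^+ 2 * B ^+ 2) by ring.
    rewrite ler_wpM2l// ler_wpM2l ?exprn_ge0 ?(ltW h0)//.
    by rewrite lerXn2r ?nnegrE.
  (* Since tau / K = h, the factor tau turns the mean into a Riemann sum whose main part telescopes
     to a difference of two values of u, at most 1 in absolute value. *)
  have tE : tau * (K%:R^-1 * \sum_(k < K) 'd u (Y k) (a k)) =
      (u (Y K) - u (Y 0%N)) +
      \sum_(k < K) (h * 'd u (Y k) (a k) - (u (Y k.+1) - u (Y k))).
    rewrite sumrB -mulr_sumr.
    have -> : \sum_(k < K) (u (Y k.+1) - u (Y k)) = u (Y K) - u (Y 0%N).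
      by rewrite -(big_mkord xpredT (fun k => u (Y k.+1) - u (Y k)))
        telescope_sumr.
    by rewrite addrC subrK mulrA -/h.
  have tn0 : tau != 0 by rewrite gt_eqF.
  move: tE; set S := _ * \sum_(k < K) _ => tE.
  rewrite -[S](mulKf tn0) tE normrM normfV (gtr0_norm tau0) mulrC ler_pdivrMr//
    mulrDl mulVf ?gt_eqF//.
  rewrite (le_trans (ler_normD _ _))// lerD//.
    have /andP[p0 p1] := u01 (Y K); have /andP[q0 q1] := u01 (Y 0%N).
    by rewrite ler_norml; apply/andP; split; lra.
  rewrite (le_trans (ler_norm_sum _ _ _))// (le_trans (ler_sum _ (fun k _ =>
    key k)))//.
  rewrite sumr_const card_ord -mulr_natl mulrCA Kh.
  by rewrite ler_wpM2r// ltW.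
- move=> y c yc; rewrite /F (eq_bigr (fun=> c)) => [|k _].
    by rewrite sumr_const card_ord -[c *+ _]mulr_natl mulKf// gt_eqF.
  apply: (yc (k%:R * h)); first by rewrite mulr_ge0 ?kK// ltW.
  by apply: le_trans hC1; apply: H1; rewrite ?kK// ltW.
Qed.

End Euler.

(** * Functions and brackets on a manifold *)

Lemma continuous_near (T U : topologicalType) (f : T -> U) (x : T) (P : set U) :
  {for x, continuous f} -> (\forall y \near f x, P y) ->
    \forall y \near x, P (f y).
Proof. by move=> cf Px; exact: (cf _ Px). Qed.

Lemma smooth_on_det (R : realType) (n m : nat) (U : set 'rV[R]_n)
    (B : 'rV[R]_n -> 'M[R]_m) : open U ->
  (forall a b, smooth_on U (fun x => B x a b)) ->
    smooth_on U (fun x => \det (B x)).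
Proof.
move=> oU sB; apply: smooth_on_sum => // s _; apply: smooth_onM => //.
  exact: smooth_on_cst.
by apply: smooth_on_prod.
Qed.

(** Cramer's rule writes the entries of the inverse as minors divided by the determinant. *)
Lemma smooth_on_invmx (R : realType) (n m : nat) (U : set 'rV[R]_n)
    (B : 'rV[R]_n -> 'M[R]_m) a b : open U ->
  (forall x, U x -> B x \in unitmx) ->
  (forall a b, smooth_on U (fun x => B x a b)) ->
  smooth_on U (fun x => invmx (B x) a b).
Proof.
move=> oU uB sB.
have sdet : smooth_on U (fun x => (\det (B x))^-1).
  apply: smooth_onV => // [x /uB|]; last exact: smooth_on_det.
  by rewrite unitmxE unitfE.
have sadj : smooth_on U (fun x => (\adj (B x)) a b).
  have : smooth_on U (fun x => (-1) ^+ (b + a) * \det (row' b (col' a (B x)))).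
    apply: smooth_onM => //; first exact: smooth_on_cst.
    apply: smooth_on_det => // c d.
    apply: (smooth_on_eq oU) (sB (lift b c) (lift a d)) => x _.
    by rewrite !mxE.
  by apply: (smooth_on_eq oU) => x _; rewrite mxE.
apply: (smooth_on_eq oU) (smooth_onM oU sdet sadj) => x /uB uBx.
by rewrite /invmx uBx [RHS]mxE.
Qed.

Section Manifold.
Context {R : realType} {n : nat} {M : topologicalType}.
Context {A : smooth_manifold R n M}.
Implicit Types (F G : M -> R) (i j : atlas_index A) (p q : M).

Lemma smooth_fun_cst (c : R) : smooth_fun (A := A) (fun=> c).
Proof. by move=> i; exact: smooth_on_cst. Qed.

Lemma smooth_funD F G : smooth_fun (A := A) F -> smooth_fun (A := A) G ->
  smooth_fun (A := A) (fun p => F p + G p).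
Proof. by move=> sF sG i; apply: smooth_onD;
  [exact: (@cimg_open _ _ _ (atlas i))|exact: sF|exact: sG]. Qed.

Lemma smooth_funM F G : smooth_fun (A := A) F -> smooth_fun (A := A) G ->
  smooth_fun (A := A) (fun p => F p * G p).
Proof. by move=> sF sG i; apply: smooth_onM;
  [exact: (@cimg_open _ _ _ (atlas i))|exact: sF|exact: sG]. Qed.

Lemma smooth_fun_prod (I : Type) (r : seq I) (P : pred I) (F : I -> M -> R) :
  (forall k, P k -> smooth_fun (A := A) (F k)) ->
  smooth_fun (A := A) (fun p => \prod_(k <- r | P k) F k p).
Proof.
move=> sF i; apply: smooth_on_prod; first exact: cimg_open.
by move=> k /sF; exact.
Qed.

Lemma compact_support_sub (F : M -> R) (C : set M) : compact C ->
  (forall p, F p != 0 -> C p) -> compact (closure [set p | F p != 0]).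
Proof.
move=> cC FC.
have sub : closure [set p | F p != 0] `<=` C.
  have /closure_id CE := compact_closed (manifold_hausdorff A) cC.
  by rewrite [X in _ `<=` X]CE; exact: closure_subset.
exact: (subclosed_compact (@closed_closure _ _) cC sub).
Qed.

Lemma Cinfty_c0 : Cinfty_c (A := A) (fun=> 0).
Proof.
split; first exact: smooth_fun_cst.
by apply: (@compact_support_sub _ set0) => [|p]; [exact: compact0|rewrite eqxx].
Qed.

Lemma Cinfty_cMl F G : Cinfty_c (A := A) F -> smooth_fun (A := A) G ->
  Cinfty_c (A := A) (fun p => F p * G p).
Proof.
move=> [sF cF] sG; split; first exact: smooth_funM.
apply: (compact_support_sub cF) => p; rewrite mulf_eq0 negb_or => /andP[Fp _].
exact: subset_closure.
Qed.

Lemma Cinfty_cD F G : Cinfty_c (A := A) F -> Cinfty_c (A := A) G ->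
  Cinfty_c (A := A) (fun p => F p + G p).
Proof.
move=> [sF cF] [sG cG]; split; first exact: smooth_funD.
apply: (compact_support_sub (compactU cF cG)) => p FG.
have [F0|F0] := eqVneq (F p) 0; last by left; exact: subset_closure.
by right; apply: subset_closure => /=; move: FG; rewrite F0 add0r.
Qed.

Lemma cfwd_cimg i p : cdom (atlas i) p -> cimg (atlas i) (cfwd (atlas i) p).
Proof. by move=> ip; exists p. Qed.

Lemma cbwd_cdom i x : cimg (atlas i) x -> cdom (atlas i) (cbwd (atlas i) x).
Proof. by move=> [p ip <-]; rewrite cfwdK. Qed.

Lemma cbwdK i x : cimg (atlas i) x -> cfwd (atlas i) (cbwd (atlas i) x) = x.
Proof. by move=> [p ip <-]; rewrite cfwdK. Qed.

Lemma cdom_near i p : cdom (atlas i) p -> \forall q \near p, cdom (atlas i) q.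
Proof. by move=> ip; apply: open_near ip; exact: cdom_open. Qed.

Lemma smooth_fun_continuous F : smooth_fun (A := A) F -> continuous F.
Proof.
move=> sF p; have [i ip] := atlas_cover A p.
have dF := smooth_fun_differentiable sF ip.
have cF : {for p, continuous ((F \o cbwd (atlas i)) \o cfwd (atlas i))}.
  apply: continuous_comp; first exact: cfwd_continuous.
  exact: differentiable_continuous.
have E : \forall q \near p, ((F \o cbwd (atlas i)) \o cfwd (atlas i)) q = F q.
  by apply: filterS (cdom_near ip) => q iq /=; rewrite cfwdK.
rewrite /continuous_at -(nbhs_singleton E).
by apply: cvg_trans cF; apply: near_eq_cvg; apply: filterS E => q.
Qed.

Definition ext_chart i (f : 'rV[R]_n -> R) : M -> R :=
  fun q => if `[< cdom (atlas i) q >] then f (cfwd (atlas i) q) else 0.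

Lemma ext_chartE i f q : cdom (atlas i) q ->
  ext_chart i f q = f (cfwd (atlas i) q).
Proof. by move=> iq; rewrite /ext_chart asboolT. Qed.

Lemma ext_chart_neq0 i f q : ext_chart i f q != 0 ->
  cdom (atlas i) q /\ f (cfwd (atlas i) q) != 0.
Proof. by rewrite /ext_chart; case: asboolP => //; rewrite eqxx. Qed.

Lemma transition_dom_open i j :
  open (cfwd (atlas i) @` (cdom (atlas i) `&` cdom (atlas j))).
Proof.
rewrite openE => x [p [ip jp] <-]; apply: filterS (cbwd_near ip jp).
move=> y [iy jy]; exists (cbwd (atlas i) y); last exact: cbwdK.
by split=> //; exact: cbwd_cdom.
Qed.

(** The image of C in M is compact, hence closed as M is Hausdorff: a point outside the chart domain
    has a neighbourhood off this image, where the extension is 0. *)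
Lemma Cinfty_c_ext_chart i f (C : set 'rV[R]_n) : compact C ->
  C `<=` cimg (atlas i) -> smooth_on setT f -> (forall x, f x != 0 -> C x) ->
  Cinfty_c (A := A) (ext_chart i f).
Proof.
move=> cC Ci sf fC.
have cC' : compact (cbwd (atlas i) @` C).
  apply: continuous_compact => //; apply: continuous_in_subspaceT => x.
  by rewrite inE => /Ci xi; exact: cbwd_continuous.
have extC q : ext_chart i f q != 0 -> (cbwd (atlas i) @` C) q.
  move=> /ext_chart_neq0[iq /fC Cq]; exists (cfwd (atlas i) q) => //.
  exact: cfwdK.
split; last exact: compact_support_sub extC.
move=> j; apply: smooth_on_pointwise => _ [q jq <-].
have [iq|iq] := pselect (cdom (atlas i) q).
  apply: (@smooth_on_near _ _ _ (f \o (cfwd (atlas i) \o cbwd (atlas j)))).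
    apply: filterS (cbwd_near jq iq) => y [jy iy] /=.
    by rewrite ext_chartE.
  have oU := @transition_dom_open j i.
  have := @smooth_on_comp _ _ _ _ setT f (cfwd (atlas i) \o cbwd (atlas j)) oU
    (fun _ _ => I) sf (@atlas_smooth _ _ _ A j i).
  by apply: smooth_on_sub => _ ->; exists q.
apply: (@smooth_on_near _ _ _ (fun=> 0)); last exact: smooth_on_cst.
have oC : open (~` (cbwd (atlas i) @` C)).
  by rewrite openC; apply: compact_closed cC'; exact: manifold_hausdorff A.
have qC : (~` (cbwd (atlas i) @` C)) q.
  by move=> [x /Ci xi xq]; apply: iq; rewrite -xq; exact: cbwd_cdom.
have := continuous_near (P := ~` (cbwd (atlas i) @` C)) (cbwd_continuous
  (cfwd_cimg jq)).
rewrite cfwdK// => /(_ (open_near oC qC)).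
apply: filterS => y yC /=; apply/esym/eqP.
by apply: contra_notT yC; exact: extC.
Qed.

Lemma chart_radius i p (O : set M) : cdom (atlas i) p -> nbhs p O ->
  exists2 r : R, 0 < r & forall x, `|x - cfwd (atlas i) p| < r ->
    cimg (atlas i) x /\ O (cbwd (atlas i) x).
Proof.
move=> ip Op.
have := continuous_near (P := O) (cbwd_continuous (cfwd_cimg ip)).
rewrite cfwdK// => /(_ Op) H.
have oi : nbhs (cfwd (atlas i) p) (cimg (atlas i)).
  exact: (open_near (@cimg_open _ _ _ (atlas i)) (cfwd_cimg ip)).
have HO : nbhs (cfwd (atlas i) p) [set y | cimg (atlas i) y /\ O (cbwd (atlas
  i) y)].
  by apply: filterS2 oi H => y; split.
have /nbhs_ballP[r /= r0 rO] := HO.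
exists r => // x xp; apply: rO; rewrite -ball_normE /ball_ /= distrC.
exact: xp.
Qed.

Lemma closed_box_compact (a : 'rV[R]_n) (r : R) : compact [set x | `|x - a| <=
  r].
Proof.
have [r0|r0] := ltP 0 r.
  have -> : [set x | `|x - a| <= r] = closed_ball a r.
    by rewrite closed_ballE//; apply/seteqP; split=> x;
      rewrite /closed_ball_ /= distrC.
  apply: bounded_closed_compact; last exact: closed_ball_closed.
  exists (`|a| + r); split; first exact: num_real.
  move=> K rK x; rewrite closed_ballE// /closed_ball_ /= distrC => xr.
  rewrite -(subrK a x) addrC (le_trans (ler_normD _ _))// (le_trans _ (ltW
    rK))//.
  by rewrite lerD2l.
have [r1|r1] := ltP r 0.
  rewrite (_ : [set x | _] = set0); first exact: compact0.
  by apply/seteqP; split=> x //= xa; have := le_lt_trans xa r1;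
    rewrite normr_lt0.
rewrite (_ : [set x | _] = [set a]); first exact: compact_set1.
apply/seteqP; split=> x /= => [xa|->]; last by rewrite subrr normr0.
have : `|x - a| <= 0 by exact: le_trans xa r0.
by rewrite normr_le0 subr_eq0 => /eqP.
Qed.

Lemma Cinfty_c_ext_box i p (r : R) (g : 'rV[R]_n -> R) : 0 < r ->
  (forall x, `|x - cfwd (atlas i) p| < 4 * r -> cimg (atlas i) x) ->
  smooth_on setT g ->
  Cinfty_c (A := A) (ext_chart i (fun x => box (cfwd (atlas i) p) r x * g x)).
Proof.
move=> r0 ri sg.
apply: (@Cinfty_c_ext_chart _ _ [set x | `|x - cfwd (atlas i) p| <= 2 * r]).
- exact: closed_box_compact.
- by move=> x /= xr; apply: ri; apply: le_lt_trans xr _; lra.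
- apply: smooth_onM => //; first exact: openT.
  exact: (csmooth_box (cfwd (atlas i) p) r0).1.
- move=> x; rewrite mulf_eq0 negb_or => /andP[/(box_supp r0)/ltW].
  by [].
Qed.

Lemma manifold_urysohn (K O : set M) : compact K -> open O -> K `<=` O ->
  exists u, [/\ Cinfty_c (A := A) u, (forall x, 0 <= u x <= 1),
    (forall x, u x != 0 -> O x) & forall x, K x -> u x = 1].
Proof.
move=> cK oO KO; apply: (glue_bumps _ _ cK); first exact: Cinfty_c0.
  move=> f g sf sg.
  have := Cinfty_cD (Cinfty_cD sf sg) (Cinfty_cMl (Cinfty_cMl sf sg.1)
    (smooth_fun_cst (-1))).
  by congr Cinfty_c; apply/funext => x; rewrite mulrN1.
move=> p /KO Op; have [i ip] := atlas_cover A p.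
have [r r0 rO] := chart_radius ip (open_near oO Op).
have r4 : 0 < r / 4 by rewrite divr_gt0.
have rE : 4 * (r / 4) = r by rewrite mulrCA divff ?mulr1.
exists (ext_chart i (fun x => box (cfwd (atlas i) p) (r / 4) x * 1)); split.
- apply: Cinfty_c_ext_box => //; last exact: smooth_on_cst.
  by rewrite rE => x /rO[].
- move=> x; rewrite /ext_chart; case: ifP => _; last by rewrite lexx ler01.
  by rewrite mulr1 box_ge0 box_le1.
- move=> x /ext_chart_neq0[ix]; rewrite mulr1 => /(box_supp r4) xr.
  by rewrite -(cfwdK ix); apply: (rO _ _).2; rewrite (lt_trans xr)//; lra.
- have := cfwd_continuous ip; rewrite /prop_for /continuous_at =>
  /cvgr_dist_le/(_ _ r4) H.
  apply: filterS2 H (cdom_near ip) => q qp iq;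
    rewrite ext_chartE// mulr1 box_eq1//.
  by rewrite distrC.
Qed.

End Manifold.

(** * The Poisson bracket as a derivative along Hamiltonian fields *)

Section Poisson.
Context {R : realType} {n : nat} {M : topologicalType}.
Context {A : smooth_manifold R n M} (om : symplectic_form A).
Implicit Types (F G : M -> R) (i j : atlas_index A) (p q : M).

(** omega (sgrad G, sgrad F) = - omega (sgrad F, sgrad G) = dF (sgrad G), by skew-symmetry and the
    definition of sgrad F. *)
Lemma poisson_diffE F G i p : smooth_fun (A := A) F -> smooth_fun (A := A) G ->
  cdom (atlas i) p -> poisson om F G p =
  'd (F \o cbwd (atlas i)) (cfwd (atlas i) p) (sgrad om G i p).
Proof.
move=> sF sG ip; rewrite (poissonE om sF sG ip).
have H := (sgradP om sF ip (sgrad om F i p)).2 erefl (sgrad om G i p).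
apply: oppr_inj; apply: etrans _ H.
rewrite /bilin; set u := sgrad om F i p; set v := sgrad om G i p.
have -> : u *m omega om i p *m v^T = (v *m (omega om i p)^T *m u^T)^T.
  by rewrite !trmx_mul !trmxK mulmxA.
by rewrite [RHS]mxE (omega_skew om ip) mulmxN mulNmx [RHS]mxE.
Qed.

Lemma smooth_on_sgrad G i a : smooth_fun (A := A) G ->
  smooth_on (cimg (atlas i)) (fun x => sgrad om G i (cbwd (atlas i) x) 0 a).
Proof.
move=> sG; have oi := @cimg_open _ _ _ (atlas i).
have : smooth_on (cimg (atlas i)) (fun x => \sum_b
    - partial b (G \o cbwd (atlas i)) x * invmx (omega om i (cbwd (atlas i) x))
      b a).
  apply: smooth_on_sum => // b _; apply: smooth_onM => //.
    by apply: smooth_onN => //; apply: smooth_on_partial; exact: sG.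
  apply: smooth_on_invmx => // [x xi|c d]; last exact: omega_smooth.
  by apply: omega_nondegenerate; exact: cbwd_cdom.
apply: (smooth_on_eq oi) => x xi; rewrite /sgrad !mxE; apply: eq_bigr => b _.
by rewrite !mxE cbwdK.
Qed.

Lemma smooth_fun_poisson F G : smooth_fun (A := A) F -> smooth_fun (A := A) G ->
  smooth_fun (A := A) (poisson om F G).
Proof.
move=> sF sG i; have oi := @cimg_open _ _ _ (atlas i).
have : smooth_on (cimg (atlas i)) (fun x => \sum_a
    sgrad om G i (cbwd (atlas i) x) 0 a * partial a (F \o cbwd (atlas i)) x).
  apply: smooth_on_sum => // a _; apply: smooth_onM => //;
    first exact: smooth_on_sgrad.
  by apply: smooth_on_partial; exact: sF.
apply: (smooth_on_eq oi) => x xi /=.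
have ix := cbwd_cdom xi.
rewrite (poisson_diffE sF sG ix) cbwdK// diff_partialE//.
by rewrite -[x in differentiable _ x](cbwdK xi);
  exact: smooth_fun_differentiable.
Qed.

Lemma sgrad_outside_support G i p : ~ closure [set q | G q != 0] p ->
  cdom (atlas i) p -> sgrad om G i p = 0.
Proof.
move=> Gp ip; rewrite /sgrad.
suff -> : local_grad G i p = 0 by rewrite oppr0 mul0mx.
apply/rowP => a; rewrite !mxE /partial.
rewrite -(derive_cst (0 : R) (cfwd (atlas i) p) (delta_mx 0 a)).
apply: near_eq_derive.
have oC : open (~` closure [set q | G q != 0]) by rewrite openC;
  exact: closed_closure.
have := continuous_near (P := ~` closure [set q | G q != 0]) (cbwd_continuous
  (cfwd_cimg ip)).
rewrite cfwdK// => /(_ (open_near oC Gp)); apply: filterS => y yC.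
apply/eqP; apply: contra_notT yC => Gy.
by apply: subset_closure.
Qed.

(** sgrad G vanishes off the support of G. Hence brackets of G with any smooth function are
    compactly supported, in particular those with the coordinates of the embedding. *)
Lemma poisson_supp F G p : smooth_fun (A := A) F -> smooth_fun (A := A) G ->
  poisson om F G p != 0 -> closure [set q | G q != 0] p.
Proof.
move=> sF sG; apply: contraPP => Gp; have [i ip] := atlas_cover A p.
rewrite (poisson_diffE sF sG ip) sgrad_outside_support// linear0.
by move/eqP.
Qed.

Lemma Cinfty_c_poisson F G : smooth_fun (A := A) F -> Cinfty_c (A := A) G ->
  Cinfty_c (A := A) (poisson om F G).
Proof.
move=> sF [sG cG]; split; first exact: smooth_fun_poisson.
by apply: (compact_support_sub (A := A) cG) => p; exact: poisson_supp.
Qed.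

Lemma Cinfty_c_bounded F : Cinfty_c (A := A) F ->
  exists2 B, 0 <= B & forall p, `|F p| <= B.
Proof.
move=> [sF cF].
have cFF : compact (F @` closure [set p | F p != 0]).
  apply: continuous_compact cF; apply: continuous_subspaceT.
  exact: smooth_fun_continuous sF.
have [B [_ FB]] := compact_bounded cFF.
exists (`|B| + 1) => [|p]; first by rewrite addr_ge0.
have [->|Fp] := eqVneq (F p) 0; first by rewrite normr0 addr_ge0.
apply: FB; first by rewrite (le_lt_trans (ler_norm B))// ltrDl.
by exists p => //; exact: subset_closure.
Qed.

Lemma is_derive_along F G (c : R -> M) (t : R) i : smooth_fun (A := A) F ->
  smooth_fun (A := A) G -> cdom (atlas i) (c t) -> {for t, continuous c} ->
  is_derive t (1 : R) (fun s => cfwd (atlas i) (c s)) (sgrad om G i (c t)) ->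
  is_derive t (1 : R) (F \o c) (poisson om F G (c t)).
Proof.
move=> sF sG ict cc dc.
have dF := smooth_fun_differentiable sF ict.
have H := is_derive_comp_diff dc dF.
rewrite (poisson_diffE sF sG ict).
apply: near_eq_is_derive H.
apply: filterS (continuous_near cc (cdom_near ict)) => s ics.
by rewrite /= cfwdK.
Qed.

End Poisson.

(** * Embedding of a compact part of a manifold *)

(** For cutoffs x_k the summands form a partition of unity wherever some x_j equals 1. *)
Lemma telescope_complement (R : comRingType) (x : nat -> R) m :
  \sum_(k < m) x k * \prod_(j < k) (1 - x j) = 1 - \prod_(j < m) (1 - x j).
Proof.
elim: m => [|m IH]; first by rewrite !big_ord0 subrr.
by rewrite !big_ord_recr /= IH; ring.
Qed.

Section Embedding.
Context {R : realType} {n : nat} {M : topologicalType}.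
Variable A : smooth_manifold R n M.

(** Injectivity compares a point of K with an arbitrary point of M, since points reached by the flow
    are not known beforehand to lie in K. The last clause takes the place of a tubular
    neighbourhood: it extends the components of the pushed-forward field to Euclidean space, and g 0
    = 0 makes the origin an equilibrium. *)
Lemma embedding (K : set M) : compact K ->
  exists (N : nat) (Phi : M -> 'rV[R]_N),
  [/\ forall l, Cinfty_c (A := A) (fun q => Phi q 0 l),
      forall p q, K p -> Phi p = Phi q -> p = q,
      forall p, K p -> Phi p != 0 &
      forall f, Cinfty_c (A := A) f -> (forall q, f q != 0 -> K q) ->
        exists g, [/\ csmooth g, g 0 = 0 & forall q, g (Phi q) = f q]].
Proof.
move=> cK.
have [ch ich] := choice (atlas_cover A).
pose ctr p := cfwd (atlas (ch p)) p.
(* The cutoffs live within radius 2 rad, so the coordinates must be exact up to there; their own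
   cutoff then reaches 4 rad, and [Cinfty_c_ext_box] asks for twice that inside the chart. *)
have /choice[rad Hrad] p : exists r : R, 0 < r /\
    forall x, `|x - ctr p| < 8 * r -> cimg (atlas (ch p)) x.
  have [r r0 rO] := chart_radius (ich p) filterT.
  exists (r / 8); split; first by rewrite divr_gt0.
  by move=> x; rewrite mulrCA divff ?mulr1// => /rO[].
have rad0 p : 0 < rad p by have [] := Hrad p.
have rad2 p : 0 < 2 * rad p by rewrite mulr_gt0.
have radi p x : `|x - ctr p| < 4 * (2 * rad p) -> cimg (atlas (ch p)) x.
  by rewrite mulrA -natrM; have [_] := Hrad p; exact.
pose chi p : M -> R := ext_chart (ch p) (fun x => box (ctr p) (rad p) x * 1).
have chiC p : Cinfty_c (A := A) (chi p).
  apply: Cinfty_c_ext_box => //; last exact: smooth_on_cst.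
  by move=> x xp; apply: radi; apply: lt_le_trans xp _; have := rad0 p; lra.
have chi_supp p q : chi p q != 0 -> cdom (atlas (ch p)) q /\
    `|cfwd (atlas (ch p)) q - ctr p| < 2 * rad p.
  by move=> /ext_chart_neq0[iq]; rewrite mulr1 => /(box_supp (rad0 p)).
have [|s Ks] := @compact_seq_cover M K (fun p => [set q | chi p q = 1]) cK.
  move=> p _.
  have := cfwd_continuous (ich p).
  rewrite /prop_for /continuous_at => /cvgr_dist_le/(_ _ (rad0 p)) H.
  apply: filterS2 H (cdom_near (ich p)) => q qp iq /=.
  by rewrite /chi ext_chartE// mulr1 box_eq1// distrC.
pose m := size s.
pose pt (k : 'I_m) := tnth (in_tuple s) k.
(* Indexing by natural numbers, with default the zero function, lets the products run over plain j <
   k. *)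
pose c (k : nat) : M -> R := nth (fun=> 0) [seq chi p | p <- s] k.
have cE (k : 'I_m) : c k = chi (pt k).
  by rewrite /c (nth_map (pt k))//; congr (chi _);
    rewrite [RHS](tnth_nth (pt k)).
pose rho (k : 'I_m) q := c k q * \prod_(j < k) (1 - c j q).
have c_smooth k : smooth_fun (A := A) (c k).
  have [ks|ks] := ltnP k m; first by rewrite (cE (Ordinal ks));
    exact: (chiC _).1.
  by rewrite /c nth_default ?size_map//; exact: smooth_fun_cst.
have rhoC k : Cinfty_c (A := A) (rho k).
  apply: Cinfty_cMl; first by rewrite cE.
  apply: smooth_fun_prod => j _.
  have := smooth_funD (smooth_fun_cst (A := A) 1)
    (smooth_funM (smooth_fun_cst (A := A) (-1)) (c_smooth j)).
  by congr smooth_fun; apply/funext => q; rewrite mulN1r.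
have rho_sum q : K q -> \sum_k rho k q = 1.
  move=> /Ks[p ps chi1].
  rewrite (telescope_complement (fun k => c k q)).
  have ks : (index p s < m)%N by rewrite index_mem.
  rewrite (bigD1 (Ordinal ks))//= (_ : c (index p s) q = 1).
    by rewrite subrr mul0r subr0.
  by rewrite /c (nth_map p)// nth_index.
have rho_neq0 q : K q -> exists k, rho k q != 0.
  move=> Kq; apply/existsP; rewrite -negb_forall; apply/negP => /forallP H.
  have := rho_sum _ Kq; rewrite big1 => [/eqP|k _];
    first by rewrite eq_sym oner_eq0.
  exact/eqP/H.
(* The coordinates of [Phi] are the [rho k] and the coordinates of the k-th
  chart,
   cut off to 1 where [rho k] is nonzero; a function f supported in K is
   recovered from them as the sum of the [rho k * f]. *)
pose co k (a : 'I_n) : M -> R :=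
  ext_chart (ch (pt k)) (fun x => box (ctr (pt k)) (2 * rad (pt k)) x * x 0 a).
pose idx := ('I_m * option 'I_n)%type.
pose N := #|{: idx}|.
pose Phi q : 'rV[R]_N := \row_l
  let: (k, o) := enum_val l : idx in if o is Some a then co k a q else rho k q.
pose at_rho (y : 'rV[R]_N) k := y 0 (enum_rank ((k, None) : idx)).
pose at_co (y : 'rV[R]_N) k : 'rV[R]_n :=
  \row_a y 0 (enum_rank ((k, Some a) : idx)).
have at_rhoE q k : at_rho (Phi q) k = rho k q.
  by rewrite /at_rho /Phi mxE enum_rankK.
have rho_chart q k : rho k q != 0 -> cdom (atlas (ch (pt k))) q /\
    `|cfwd (atlas (ch (pt k))) q - ctr (pt k)| < 2 * rad (pt k).
  by rewrite /rho mulf_eq0 negb_or cE => /andP[/chi_supp].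
have at_coE q k : rho k q != 0 -> at_co (Phi q) k = cfwd (atlas (ch (pt k))) q.
  move=> /rho_chart[iq qr]; apply/rowP => a; rewrite !mxE enum_rankK.
  by rewrite /co ext_chartE// box_eq1 ?mul1r// ltW.
have PhiC l : Cinfty_c (A := A) (fun q => Phi q 0 l).
  rewrite /Phi; under eq_fun do rewrite mxE.
  case: (enum_val l) => k [a|]; last exact: rhoC.
  exact: (Cinfty_c_ext_box (rad2 (pt k)) (@radi (pt k)) (smooth_on_coord setT
    a)).
exists N, Phi; split=> //.
- move=> p q /rho_neq0[k kp] PQ.
  have kq : rho k q != 0 by rewrite -at_rhoE -PQ at_rhoE.
  have [ip _] := rho_chart _ _ kp; have [iq _] := rho_chart _ _ kq.
  by rewrite -(cfwdK ip) -(cfwdK iq) -(at_coE _ _ kp) -(at_coE _ _ kq) PQ.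
- move=> p /rho_neq0[k]; apply: contraNneq => P0.
  by rewrite -at_rhoE P0 /at_rho mxE.
move=> f [sf cf] fK.
have /choice[B HB] l : exists B, 0 <= B /\ forall q, `|Phi q 0 l| <= B.
  by have [B B0 HB] := Cinfty_c_bounded (PhiC l); exists B.
have B0 l : 0 <= B l by have [] := HB l.
pose S := \sum_l B l + 1.
have S0 : 0 < S by rewrite ltr_wpDl// sumr_ge0.
have PhiS q : `|Phi q - 0| <= S.
  rewrite subr0; apply: norm_row_le => [|l]; first exact: ltW.
  have [_ /(_ q)/le_trans] := HB l; apply.
  by rewrite /S (bigD1 l)//= -addrA lerDl addr_ge0// sumr_ge0.
pose loc k (x : 'rV[R]_n) := box (ctr (pt k)) (2 * rad (pt k)) x *
   (f \o cbwd (atlas (ch (pt k)))) x.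
have sloc k : csmooth (loc k).
  apply: (@csmooth_cutoff _ _ (cimg (atlas (ch (pt k))))
    [set x | `|x - ctr (pt k)| <= 2 * (2 * rad (pt k))]).
  - exact: cimg_open.
  - apply: (compact_closed (@norm_hausdorff R 'rV[R]_n)).
    exact: closed_box_compact.
  - move=> x /= xr; apply: radi; apply: le_lt_trans xr _.
    by have := rad0 (pt k); lra.
  - exact: csmooth_box.
  - by move=> x /(box_supp (rad2 _))/ltW.
  - exact: sf.
(* S bounds the norm of Phi, so the box is 1 on the image of Phi while making g compactly
   supported. *)
exists (fun y => box 0 S y * \sum_k at_rho y k * loc k (at_co y k)); split.
- apply: csmoothMl; first exact: csmooth_box.
  have oT : open [set: 'rV[R]_N] by exact: openT.
  apply: smooth_on_sum => // k _; apply: smooth_onM => //;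
    first exact: smooth_on_coord.
  apply: (@smooth_on_comp _ _ _ setT setT (loc k) (fun y => at_co y k)) => //.
    exact: (sloc k).1.
  move=> a; rewrite /at_co; under eq_fun do rewrite mxE.
  exact: smooth_on_coord.
- by rewrite big1 ?mulr0// => k _; rewrite /at_rho mxE mul0r.
move=> q; rewrite box_eq1// mul1r (eq_bigr (fun k => rho k q * f q)).
  rewrite -mulr_suml; have [->|/fK/rho_sum ->] := eqVneq (f q) 0.
    by rewrite mulr0.
  by rewrite mul1r.
move=> k _; rewrite at_rhoE.
have [->|kq] := eqVneq (rho k q) 0; first by rewrite !mul0r.
rewrite at_coE// /loc /=; have [iq qr] := rho_chart _ _ kq.
by rewrite box_eq1 ?mul1r ?cfwdK// ltW.
Qed.

End Embedding.

(** * Hamiltonian flow *)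

Section HamiltonianFlow.
Context {R : realType} {n : nat} {M : topologicalType}.
Context {A : smooth_manifold R n M} (om : symplectic_form A).
Implicit Types (F G : M -> R) (i j : atlas_index A) (p q : M) (c : R -> M).

(** One chart is enough: [ham_curve_chart] transports the equation to every other chart around the
    point. *)
Definition ham_curve_at G c (s : R) := {for s, continuous c} /\
  exists2 i, cdom (atlas i) (c s) &
    is_derive s (1 : R) (fun r => cfwd (atlas i) (c r)) (sgrad om G i (c s)).

Definition ham_arc G (d : R) q := exists2 c, c 0 = q &
  forall s, `|s| <= d -> ham_curve_at G c s.

Lemma ham_curve_chart G c s j : smooth_fun (A := A) G -> ham_curve_at G c s ->
  cdom (atlas j) (c s) ->
  is_derive s (1 : R) (fun r => cfwd (atlas j) (c r)) (sgrad om G j (c s)).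
Proof.
move=> sG [cc [i ic dc]] jc.
have dt := transition_differentiable ic jc.
have H := is_derive_comp_diff dc dt.
rewrite -(sgrad_transition om sG ic jc).
apply: near_eq_is_derive H.
by apply: filterS (continuous_near cc (cdom_near ic)) => r ir /=; rewrite cfwdK.
Qed.

(** Cut off in a chart, sgrad G becomes a global Lipschitz field with a flow. An orbit starting
    within r of the centre moves by at most r during the time r / (B + 1), so it stays where the
    cutoff is 1. *)
Lemma ham_arc_near G p : smooth_fun (A := A) G ->
  exists2 d : R, 0 < d & \forall q \near p, ham_arc G d q.
Proof.
move=> sG; have [i ip] := atlas_cover A p.
have [r0 r00 rO] := chart_radius ip filterT.
pose r := r0 / 8; have r_gt0 : 0 < r by rewrite divr_gt0.
set a := cfwd (atlas i) p in rO.
have ri x : `|x - a| < 8 * r -> cimg (atlas i) x.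
  by rewrite /r mulrCA divff ?mulr1// => /rO[].
have r2 : 0 < 2 * r by rewrite mulr_gt0.
pose V (x : 'rV[R]_n) : 'rV[R]_n :=
  \row_k (box a (2 * r) x * sgrad om G i (cbwd (atlas i) x) 0 k).
have sV k : csmooth (fun x => V x 0 k).
  rewrite /V; under eq_fun do rewrite mxE.
  apply: (@csmooth_cutoff _ _ (cimg (atlas i)) [set x | `|x - a| <= 2 * (2 *
    r)]).
  - exact: cimg_open.
  - apply: (compact_closed (@norm_hausdorff R 'rV[R]_n)).
    exact: closed_box_compact.
  - by move=> x /= xr; apply: ri; apply: le_lt_trans xr _; lra.
  - exact: csmooth_box.
  - by move=> x /(box_supp r2)/ltW.
  - exact: smooth_on_sgrad.
have VE x : `|x - a| <= 2 * r -> V x = sgrad om G i (cbwd (atlas i) x).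
  by move=> xr; apply/rowP => k; rewrite mxE box_eq1// mul1r.
have [L L0 VL] := field_lipschitz sV.
have [B B0 VB] := field_bounded sV.
have [th [th0 thd]] := flow_exists L0 VL VB.
have B1 : 0 < B + 1 by rewrite ltr_wpDl.
exists (r / (B + 1)); first by rewrite divr_gt0.
have := cfwd_continuous ip.
rewrite /prop_for /continuous_at => /cvgr_dist_le/(_ _ r_gt0) H.
apply: filterS2 H (cdom_near ip) => q qp iq.
exists (fun s => cbwd (atlas i) (th s (cfwd (atlas i) q))) => [|s sd].
  by rewrite th0 cfwdK.
set x := cfwd (atlas i) q in qp *.
have xs : `|th s x - a| <= 2 * r.
  rewrite -(subrK x (th s x)) -addrA (le_trans (ler_normD _ _))//.
  have H1 := flow_speed th0 thd s x VB.
  have H2 : B * `|s| <= r.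
    rewrite (le_trans (ler_wpM2l B0 sd))// mulrCA ler_piMr ?(ltW r_gt0)//.
    by rewrite ler_pdivrMr// mul1r lerDl.
  have H3 : `|x - a| <= r by rewrite distrC.
  by lra.
have is_ : cimg (atlas i) (th s x) by apply: ri; apply: le_lt_trans xs _; lra.
have cth : {for s, continuous (fun r => th r x)}.
  exact: is_derive_continuous (thd x s).
split.
  apply: (@continuous_comp _ _ _ (fun r => th r x)) => //.
  exact: cbwd_continuous.
exists i; first exact: cbwd_cdom.
rewrite -VE//.
apply: near_eq_is_derive (thd x s).
have := continuous_near cth (open_near (@cimg_open _ _ _ (atlas i)) is_).
by apply: filterS => t it; rewrite cbwdK.
Qed.

Lemma ham_arc_uniform G (S : set M) : smooth_fun (A := A) G -> compact S ->
  exists2 d : R, 0 < d & forall q, S q -> ham_arc G d q.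
Proof.
move=> sG /compact_near_coveringP cS.
have : \forall d \near (0 : R)^'+, S `<=` ham_arc G d.
  apply: cS => p Sp; have [d d0 Hd] := ham_arc_near p sG.
  near=> q e => /=.
  have [c c0 cd] : ham_arc G d q by near: q.
  exists c => // s se; apply: cd; apply: le_trans se _; near: e.
  exact: nbhs_right_le.
move=> H.
have [d [d0 Hd]] : exists d : R, 0 < d /\ S `<=` ham_arc G d.
  near ((0 : R)^'+) => d; exists d; split; first by [].
  by near: d.
by exists d.
Unshelve. all: end_near. Qed.

Variables (N : nat) (Phi : M -> 'rV[R]_N) (W : 'rV[R]_N -> 'rV[R]_N).
Variables (G : M -> R) (theta : R -> 'rV[R]_N -> 'rV[R]_N) (K : set M).
Hypothesis GC : Cinfty_c (A := A) G.
Hypothesis sPhi : forall l, smooth_fun (A := A) (fun q => Phi q 0 l).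
Hypothesis sW : forall l, csmooth (fun y => W y 0 l).
Hypothesis WPhi : forall q l, W (Phi q) 0 l = poisson om (fun q => Phi q 0 l) G
  q.
Hypothesis Phi_inj : forall p q, K p -> Phi p = Phi q -> p = q.
Hypothesis suppK : closure [set q | G q != 0] `<=` K.
Hypothesis theta0 : forall y, theta 0 y = y.
Hypothesis theta_derive : forall y (t : R),
  is_derive t (1 : R) (fun s => theta s y) (W (theta t y)).

Lemma flow_const y t : W y = 0 -> theta t y = y.
Proof.
move=> Wy.
have [L L0 WL] := field_lipschitz sW.
have [B B0 WB] := field_bounded sW.
apply: (@integral_curve_unique _ _ W L B L0 WL WB `|t| (fun s => theta s y)
  (fun=> y)) => //.
by move=> s _; rewrite Wy; exact: is_derive_cst.
Qed.

(** Both sides are integral curves of W with the same origin, as the coordinates of Phi along a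
    Hamiltonian curve have derivative {Phi_l, G}. *)
Lemma ham_arc_image c d s : (forall s, `|s| <= d -> ham_curve_at G c s) ->
  `|s| <= d -> Phi (c s) = theta s (Phi (c 0)).
Proof.
move=> Hc sd.
have [L L0 WL] := field_lipschitz sW.
have [B B0 WB] := field_bounded sW.
apply: (@integral_curve_unique _ _ W L B L0 WL WB d (fun s => Phi (c s))
  (fun s => theta s (Phi (c 0)))) => //.
move=> r rd; apply: is_derive_row => l; rewrite WPhi.
have [cc [i ic dc]] := Hc r rd.
exact: (is_derive_along (sPhi l) GC.1 ic cc dc).
Qed.

Lemma field_outside_support q : ~ closure [set q | G q != 0] q -> W (Phi q) = 0.
Proof.
move=> qS; apply/rowP => l; rewrite WPhi mxE; apply/eqP.
by apply: contra_notT qS; apply: poisson_supp => //; exact: GC.1.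
Qed.

(* Arcs in M exist for a time bounded below, and their images under [Phi] are
   orbits of [theta]; hence [theta] never leaves the image of the support. *)
Lemma flow_preserves_image t q : closure [set q | G q != 0] q ->
  exists q', closure [set q | G q != 0] q' /\ Phi q' = theta t (Phi q).
Proof.
have [d d0 Hd] := ham_arc_uniform GC.1 GC.2.
have step s p : `|s| <= d -> closure [set q | G q != 0] p ->
    exists p', closure [set q | G q != 0] p' /\ Phi p' = theta s (Phi p).
  move=> sd Sp; have [c c0 Hc] := Hd p Sp.
  have E := ham_arc_image Hc sd; rewrite c0 in E.
  (* If c s had left the support, its image would be an equilibrium of W; running theta backwards
     gives Phi p = Phi (c s), hence p = c s, a contradiction. *)
  exists (c s); split=> //; apply: contrapT => nS.
  have Wc := field_outside_support nS.
  have : Phi p = Phi (c s).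
    rewrite -(theta0 (Phi p)) -(subrr s) (flow_add sW theta0 theta_derive) -E.
    exact: flow_const.
  by move=> /(Phi_inj (suppK Sp)) pE; apply: nS; rewrite -pE.
have iter_step k s p : `|s| <= k%:R * d -> closure [set q | G q != 0] p ->
    exists p', closure [set q | G q != 0] p' /\ Phi p' = theta s (Phi p).
  elim: k s p => [|k IH] s p.
    by rewrite mul0r normr_le0 => /eqP -> Sp; exists p; rewrite theta0.
  move=> sk Sp; pose s1 := s / k.+1%:R.
  have k1 : (k.+1%:R : R) != 0 by rewrite pnatr_eq0.
  have sE : s = k%:R * s1 + s1.
    by rewrite -[X in _ + X]mul1r -mulrDl natr1 /s1 mulrCA divff ?mulr1.
  have s1d : `|s1| <= d.
    by rewrite /s1 normrM normfV [`|k.+1%:R|]ger0_norm// ler_pdivrMr ?ltr0n//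
      mulrC.
  have [|p1 [Sp1 E1]] := IH (k%:R * s1) p _ Sp.
    by rewrite normrM ger0_norm// ler_wpM2l.
  have [p2 [Sp2 E2]] := step s1 p1 s1d Sp1.
  exists p2; split=> //.
  by rewrite E2 E1 -(flow_add sW theta0 theta_derive) -sE.
move=> Sq; apply: (iter_step (Num.bound (`|t| / d))) Sq.
by rewrite -ler_pdivrMr// ltW// archi_boundP// divr_ge0// ltW.
Qed.

(** Points off the support stay fixed; on it, orbits of theta are pulled back pointwise through Phi.
    This choice carries no regularity in t, which comes from identifying the orbit near each time
    with the local arc through the current point. *)
Lemma ham_flow_exists : exists g, is_ham_flow om G g /\
  forall t q, Phi (g t q) = theta t (Phi q).
Proof.
pose S := closure [set q | G q != 0].
have /choice[g Hg] (tq : R * M) : exists q', [/\ Phi q' = theta tq.1 (Phi tq.2),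
    S tq.2 -> S q' & ~ S tq.2 -> q' = tq.2].
  case: tq => t q /=; have [Sq|Sq] := pselect (S q).
    by have [q' [Sq' E]] := flow_preserves_image t Sq; exists q'.
  exists q; split=> //; apply/esym/flow_const.
  exact: field_outside_support.
exists (fun t q => g (t, q)); split; last first.
  by move=> t q; have [] := Hg (t, q).
have [d d0 Hd] := ham_arc_uniform GC.1 GC.2.
move=> x; have [Sx|Sx] := pselect (S x); last first.
  have gE t : g (t, x) = x by have [_ _] := Hg (t, x); exact.
  have gE' : (fun t => g (t, x)) = fun=> x by apply/funext.
  split; [exact: gE|rewrite gE'; exact: cst_continuous|].
  move=> t i; rewrite gE => ix.
  rewrite (_ : (fun s => _) = fun=> cfwd (atlas i) x); last first.
    by apply/funext => s; rewrite gE.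
  by rewrite sgrad_outside_support//; exact: is_derive_cst.
have gS t : S (g (t, x)) by have [_ + _] := Hg (t, x); exact.
have gPhi t : Phi (g (t, x)) = theta t (Phi x) by have [] := Hg (t, x).
have curve t : ham_curve_at G (fun s => g (s, x)) t.
  have [c c0 Hc] := Hd _ (gS t).
  have E s : `|s| <= d -> c s = g (t + s, x).
    move=> sd; apply/esym/(Phi_inj (suppK (gS (t + s)))).
    by rewrite gPhi (ham_arc_image Hc sd) c0 gPhi (flow_add sW theta0
      theta_derive).
  have nearE : \forall s \near t, c (- t + s) = g (s, x).
    near=> s; rewrite E; last first.
      rewrite addrC distrC; near: s; exact: cvgr_dist_le.
    by rewrite addrA subrr add0r.
  have [|cc [i ic dc]] := Hc 0; first by rewrite normr0 ltW.
  have gtE : g (t, x) = c 0 by rewrite E ?normr0 ?(ltW d0)// addr0.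
  split.
    have sc : {for t, continuous (fun s : R => - t + s)}.
      by apply: continuousD; [exact: cst_continuous|exact: cvg_id].
    have cct : {for t, continuous (c \o (fun s : R => - t + s))}.
      by apply: continuous_comp => //; rewrite addNr.
    rewrite /prop_for /continuous_at /= gtE.
    rewrite /prop_for /continuous_at /= addNr in cct.
    exact: (cvg_trans (near_eq_cvg nearE) cct).
  exists i; first by rewrite gtE.
  rewrite gtE.
  have dct : is_derive (- t + t) (1 : R) (fun s => cfwd (atlas i) (c s))
      (sgrad om G i (c 0)) by rewrite addNr.
  apply: near_eq_is_derive (is_derive_shift_time dct).
  by apply: filterS nearE => s ->.
split.
- apply/esym/(Phi_inj (suppK Sx)).
  by rewrite gPhi theta0.
- by move=> t; have [] := curve t.
- by move=> t i ix; apply: ham_curve_chart => //; exact: GC.1.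
Unshelve. all: end_near. Qed.

End HamiltonianFlow.

(** * The two inequalities *)

(** Joint continuity is what makes the tubes swept out by compact sets compact. It combines
    stability in the initial point at the fixed time t with the bound on the speed. *)
Lemma flow_continuous (R : realType) (N : nat) (W : 'rV[R]_N -> 'rV[R]_N)
    (theta : R -> 'rV[R]_N -> 'rV[R]_N) :
  (forall l, csmooth (fun y => W y 0 l)) -> (forall y, theta 0 y = y) ->
  (forall y (t : R),
    is_derive t (1 : R) (fun s => theta s y) (W (theta t y))) ->
  continuous (fun ty : R * 'rV[R]_N => theta ty.1 ty.2).
Proof.
move=> sW theta0 thetad.
have [L L0 WL] := field_lipschitz sW.
have [B B0 WB] := field_bounded sW.
move=> [t y]; apply/cvgrPdist_le => e e0.
pose D := 2 * expR (2 * L * `|t|).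
have D0 : 0 < D by rewrite mulr_gt0 ?expR_gt0.
have e2 : 0 < e / 2 by rewrite divr_gt0.
have B1 : 0 < B + 1 by rewrite ltr_wpDl.
near=> sz => /=.
have H1 : `|theta t y - theta t sz.2| <= e / 2.
  have := @flow_stability _ _ W L B L0 WL WB `|t| (fun s => theta s y)
    (fun s => theta s sz.2) t (fun s _ => thetad y s) (fun s _ => thetad sz.2
      s) (lexx _).
  rewrite !theta0 => /le_trans; apply; rewrite mulrAC -/D mulrC -ler_pdivlMr//.
  near: sz; apply: (@cvgr_dist_le _ _ _ _ _ (fun sz : R * 'rV[R]_N => sz.2) y).
    exact: cvg_snd.
  by rewrite divr_gt0.
have H2 : `|theta sz.1 sz.2 - theta t sz.2| <= e / 2.
  have -> : theta sz.1 sz.2 = theta (sz.1 - t) (theta t sz.2).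
    by rewrite -(flow_add sW theta0 thetad) addrC subrK.
  apply: le_trans (flow_speed theta0 thetad _ _ WB) _.
  apply: (@le_trans _ _ ((B + 1) * `|sz.1 - t|)).
    by rewrite ler_wpM2r// lerDl.
  rewrite mulrC -ler_pdivlMr// distrC.
  near: sz; apply: (@cvgr_dist_le _ _ _ _ _ (fun sz : R * 'rV[R]_N => sz.1) t).
    exact: cvg_fst.
  by rewrite divr_gt0.
rewrite -(subrK (theta t sz.2) (theta t y)) -addrA (le_trans (ler_normD _ _))//.
by rewrite [e]splitr lerD// distrC.
Unshelve. all: end_near. Qed.

Section Duality.
Context {R : realType} {n : nat} {M : topologicalType}.
Context {A : smooth_manifold R n M} (om : symplectic_form A).
Implicit Types (F G : M -> R).

Lemma sup_norm_ub F : Cinfty_c (A := A) F -> forall p, `|F p| <= sup_norm F.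
Proof.
move=> FC p; have [B B0 FB] := Cinfty_c_bounded FC.
apply: ub_le_sup; last by exists p.
by exists B => _ [q _ <-].
Qed.

(** On an empty M the norm is the default value 0 of [sup] at the empty set. *)
Lemma sup_norm_empty F : ~ inhabited M -> sup_norm F = 0.
Proof.
move=> Me; rewrite /sup_norm (_ : [set _ | _ in _] = set0) ?sup0//.
by apply/seteqP; split=> [x [q _ _]|//]; case: Me; exists.
Qed.

Lemma sup_norm_le F (c : R) : 0 <= c -> (forall p, `|F p| <= c) ->
  sup_norm F <= c.
Proof.
move=> c0 Fc; have [[p]|Me] := pselect (inhabited M).
  by apply: ge_sup => [|_ [q _ <-]//]; exists `|F p|, p.
by rewrite sup_norm_empty.
Qed.

Lemma sup_norm_ge0 F : Cinfty_c (A := A) F -> 0 <= sup_norm F.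
Proof.
move=> FC; have [[p]|Me] := pselect (inhabited M).
  exact: le_trans (normr_ge0 _) (sup_norm_ub FC p).
by rewrite sup_norm_empty.
Qed.

Lemma chord_lower_bound F G g (X0 X1 : set M) x (t : R) :
  Cinfty_c (A := A) F -> Cinfty_c (A := A) G -> separates F X0 X1 ->
  is_ham_flow om G g -> X0 x -> X1 (g t x) ->
  1 <= `|t| * sup_norm (poisson om F G).
Proof.
move=> FC GC [F0 F1] hg xX0 xX1.
have [g0 cg dg] := hg x.
have dFg s : is_derive s (1 : R) (F \o (fun s => g s x)) (poisson om F G (g s
  x)).
  have [i ig] := atlas_cover A (g s x).
  exact: (is_derive_along FC.1 GC.1 ig (cg s) (dg s i ig)).
have [c _] := mean_value_R 0 t dFg.
rewrite /= g0 subr0 => E.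
have H : 1 <= F (g t x) - F x.
  by have := F0 _ xX0; have := F1 _ xX1; lra.
apply: le_trans H _; rewrite E (le_trans (ler_norm _))// normrM mulrC
  ler_wpM2l//.
by apply: sup_norm_ub; exact: Cinfty_c_poisson FC.1 GC.
Qed.

Lemma Cinfty_c_sum (I : Type) (r : seq I) (F : I -> M -> R) :
  (forall k, Cinfty_c (A := A) (F k)) ->
  Cinfty_c (A := A) (fun p => \sum_(k <- r) F k p).
Proof.
move=> FC; elim: r => [|k r IH].
  have := Cinfty_c0 (A := A); congr Cinfty_c.
  by apply/funext => p; rewrite big_nil.
have := Cinfty_cD (FC k) IH; congr Cinfty_c.
by apply/funext => p; rewrite big_cons.
Qed.

(** The slack e pays for the discretisation. Strictness of tau < |t| also excludes chords of time
    exactly tau or -tau, so the tubes over the closed interval [0, tau] are disjoint compact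
    sets. *)
Lemma poisson_upper_bound G (X0 X1 : set M) (tau e : R) :
  compact X0 -> compact X1 -> Cinfty_c (A := A) G -> 0 < tau -> 0 < e ->
  (forall g t x, is_ham_flow om G g -> X0 x -> X1 (g t x) -> tau < `|t|) ->
  exists F, [/\ Cinfty_c (A := A) F, separates F X0 X1 &
    forall p, `|poisson om F G p| <= tau^-1 + e].
Proof.
move=> cX0 cX1 GC tau0 e0 chord.
have [N [Phi [PhiC Phi_inj Phi_neq0 Phi_factor]]] :=
  embedding A (compactU (compactU cX0 cX1) GC.2).
set K := _ `|` closure _ in Phi_inj Phi_neq0 Phi_factor.
have suppK : closure [set q | G q != 0] `<=` K by move=> q; right.
have sPhi l := (PhiC l).1.
have /choice[w Hw] l : exists w, [/\ csmooth w, w 0 = 0 &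
    forall q, w (Phi q) = poisson om (fun q => Phi q 0 l) G q].
  apply: Phi_factor; first exact: Cinfty_c_poisson (sPhi l) GC.
  by move=> q qP; apply: suppK; exact: poisson_supp (sPhi l) GC.1 qP.
pose W (y : 'rV[R]_N) : 'rV[R]_N := \row_l w l y.
have sW l : csmooth (fun y => W y 0 l).
  by rewrite /W; under eq_fun do rewrite mxE; have [] := Hw l.
have WPhi q l : W (Phi q) 0 l = poisson om (fun q => Phi q 0 l) G q.
  by rewrite mxE; have [] := Hw l.
have W0 : W 0 = 0 by apply/rowP => l; rewrite !mxE; have [] := Hw l.
have [L L0 WL] := field_lipschitz sW.
have [B B0 WB] := field_bounded sW.
have [theta [theta0 thetad]] := flow_exists L0 WL WB.
have [g [hg gPhi]] :=
  ham_flow_exists GC sPhi sW WPhi Phi_inj suppK theta0 thetad.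
have theta_add := flow_add sW theta0 thetad.
have thetaN t z : theta (- t) (theta t z) = z.
  by rewrite -theta_add subrr theta0.
pose slab X := (fun ty : R * 'rV[R]_N => theta ty.1 ty.2) @`
  (`[0, tau]%classic `*` (Phi @` X)).
have slab_compact X : compact X -> compact (slab X).
  move=> cX; apply: continuous_compact.
    by apply: continuous_subspaceT; exact: flow_continuous sW theta0 thetad.
  apply: compact_setX; first exact: segment_compact.
  apply: continuous_compact => //; apply: continuous_subspaceT => p.
  apply: continuous_row => l; exact: smooth_fun_continuous (sPhi l) p.
(* The point 0 is the image of all points of M far away: keeping the cutoff zero there gives [Ft]
   the value 0 at 0, hence F compact support. *)
pose A0 := slab X0 `|` [set 0].
have cA0 : closed A0.
  apply: (compact_closed (@norm_hausdorff R 'rV[R]_N)).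
  by apply: compactU; [exact: slab_compact|exact: compact_set1].
have disj : slab X1 `<=` ~` A0.
  move=> _ [[t _] /= [+ [x1 x1X <-]] <-]; rewrite in_itv /= => /andP[t0 tt].
  have x1K : K x1 by left; right.
  move=> [[[s _] /= [+ [x0 x0X <-]]] sE|/= z0].
    rewrite in_itv /= => /andP[s0 st].
    (* A common point of the tubes produces a chord of signed time s - t, at most tau in absolute
       value. *)
    have E : Phi x1 = Phi (g (s - t) x0).
      by rewrite gPhi theta_add sE thetaN.
    have x1E := Phi_inj _ _ x1K E.
    have := chord g (s - t) x0 hg x0X; rewrite -x1E => /(_ x1X).
    by apply/negP; rewrite -leNgt ler_norml; apply/andP; lra.
  (* As W 0 = 0, the orbit through 0 is constant: reaching 0 would mean Phi x1 = 0. *)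
  have := Phi_neq0 _ x1K; rewrite -(thetaN t (Phi x1)) z0.
  by rewrite (flow_const sW theta0 thetad) ?eqxx.
have oA0 : open (~` A0) by rewrite openC.
have [u0 [su0 u001 u0A0 u0A1]] := smooth_urysohn (slab_compact _ cX1) oA0 disj.
have {}u0A0 z : A0 z -> u0 z = 0.
  by move=> zA0; apply/eqP; apply: contraPT zA0; exact: u0A0.
have [L1 L10 u0L] := csmooth_lipschitz su0.
(* u is 0 where u0 <= 1/4 and 1 where u0 >= 3/4. With u0 Lipschitz of constant L1, it is constant on
   a tube of width 1 / (4 (L1 + 1)) around each slab, as [euler_average] requires. *)
pose u (z : 'rV[R]_N) := step (2 * u0 z - 2^-1).
have su : csmooth u.
  split.
    apply: smooth_on_step; first exact: openT.
    apply: smooth_onB; [exact: openT| |exact: smooth_on_cst].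
    by apply: smooth_onM; [exact: openT|exact: smooth_on_cst|exact: su0.1].
  have [r u0r] := su0.2; exists r => z; rewrite /u => uz; apply: u0r.
  by apply: contra_neq uz => ->; rewrite step_eq0// mulr0 sub0r oppr_le0.
have u01 z : 0 <= u z <= 1 by rewrite /u step_ge0 step_le1.
pose e1 := Num.min e (4 * (L1 + 1))^-1.
have e10 : 0 < e1.
  by rewrite lt_min e0 invr_gt0 mulr_gt0// ltr_wpDl.
have [Ft [sFt dFt Ftc]] := euler_average sW theta0 thetad su u01 tau0 e10.
have near_u0 z z' : `|z - z'| <= e1 -> `|u0 z - u0 z'| <= 4^-1.
  move=> zz; apply: le_trans (u0L _ _) _.
  have L11 : 0 < L1 + 1 by rewrite ltr_wpDl.
  apply: (@le_trans _ _ ((L1 + 1) * (4 * (L1 + 1))^-1)).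
    apply: ler_pM => //; first by rewrite lerDl.
    by rewrite (le_trans zz)// ge_min lexx orbT.
  by rewrite invfM mulrCA divff ?mulr1// gt_eqF.
have Ft_on0 z : (forall s, 0 <= s <= tau -> A0 (theta s z)) -> Ft z = 0.
  move=> zA; apply: Ftc => s z' sT /near_u0.
  rewrite (u0A0 _ (zA s sT)) subr0 => /(le_trans (ler_norm _)) H.
  by rewrite /u step_eq0//; lra.
have Ft0 : Ft 0 = 0.
  apply: Ft_on0 => s _; right; exact: flow_const sW theta0 thetad _ _ W0.
pose F := Ft \o Phi.
have sF : smooth_fun (A := A) F.
  move=> i; apply: (@smooth_on_comp _ _ _ _ setT Ft (Phi \o cbwd (atlas i))) =>
    //.
    exact: cimg_open.
  by move=> l; exact: (sPhi l i).
have FC : Cinfty_c (A := A) F.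
  split=> //.
  (* The sum of the squares of the coordinates of Phi is compactly supported and vanishes only where
     Phi does, and there F = Ft 0 = 0. *)
  have QC := Cinfty_c_sum (index_enum 'I_N) (fun l => Cinfty_cMl (PhiC l) (sPhi
    l)).
  apply: (compact_support_sub (A := A) QC.2) => p; rewrite /F /= => Fp.
  apply: subset_closure => /=; apply: contra_neq Fp => Q0.
  suff -> : Phi p = 0 by [].
  apply/rowP => l; rewrite mxE; apply/eqP; rewrite -sqrf_eq0 expr2.
  move/eqP : Q0; rewrite psumr_eq0 => [/allP/(_ l (mem_index_enum l))//|k _].
  by rewrite -expr2 sqr_ge0.
exists F; split=> //.
- split=> x xX.
    rewrite /F /= Ft_on0// => s sT; left; exists (s, Phi x) => //=; split.
      by rewrite /= in_itv.
    by exists x.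
  rewrite /F /= (Ftc (Phi x) 1)// => s z sT /near_u0.
  rewrite (u0A1 (theta s (Phi x))); last first.
    exists (s, Phi x) => //=; split; first by rewrite /= in_itv.
    by exists x.
  by rewrite ler_norml => /andP[H _]; rewrite /u step_eq1//; lra.
move=> p; have [i ip] := atlas_cover A p.
rewrite (poisson_diffE om sF GC.1 ip).
pose x := cfwd (atlas i) p; pose v := sgrad om G i p.
have dPhil l : differentiable (fun y => (Phi \o cbwd (atlas i)) y 0 l) x.
  exact: (smooth_fun_differentiable (sPhi l) ip).
have dPhi : differentiable (Phi \o cbwd (atlas i)) x.
  by apply: differentiable_row => l; exact: dPhil.
have PE : (Phi \o cbwd (atlas i)) x = Phi p by rewrite /x /= cfwdK.
have dF : differentiable Ft ((Phi \o cbwd (atlas i)) x).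
  exact: smooth_on_differentiable sFt Logic.I.
(* sgrad G and W are Phi-related, so the bracket is the derivative of [Ft] along W. *)
have vE : 'd (Phi \o cbwd (atlas i)) x v = W (Phi p).
  apply/rowP => l; rewrite WPhi (poisson_diffE om (sPhi l) GC.1 ip).
  by rewrite coord_diff// deriveE.
have -> : 'd (F \o cbwd (atlas i)) x v = 'd Ft (Phi p) (W (Phi p)).
  rewrite -vE -PE; exact: (congr1 (@^~ v) (diff_comp dPhi dF)).
by rewrite (le_trans (dFt (Phi p)))// lerD2l ge_min lexx.
Qed.

End Duality.
Local Open Scope ereal_scope.

(** * Passage to the infimum and the supremum in the extended reals *)

Section MainBounds.
Context {R : realType} {n : nat} {M : topologicalType}.
Context {A : smooth_manifold R n M} (om : symplectic_form A).
Variables (X0 X1 Y0 Y1 : set M).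

Lemma chord_time_ge0 G : 0 <= chord_time om X0 X1 G.
Proof. by apply: le_ereal_inf_tmp => _ [t _ <-]; rewrite lee_fin. Qed.

Lemma chord_time_ge (F G : M -> R) : Cinfty_c (A := A) F ->
  Cinfty_c (A := A) G ->
  separates F X0 X1 -> (sup_norm (poisson om F G))%:E^-1 <= chord_time om X0 X1
    G.
Proof.
move=> FC GC sepF; have PC := Cinfty_c_poisson om FC.1 GC.
have c0 := sup_norm_ge0 PC.
apply: le_ereal_inf_tmp => _ [t [g [x [hg x0 x1]]] <-].
have := chord_lower_bound FC GC sepF hg x0 x1.
(* For c = 0 the inverse is +oo, and the chord inequality becomes 1 <= 0: a bracket of norm 0 admits
   no chord. *)
set c := sup_norm _ in c0 *; rewrite inver; case: eqP => [->|/eqP cn0].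
  by rewrite mulr0 ler10.
have cp : (0 < c)%R by rewrite lt_def cn0.
by rewrite lee_fin -ler_pdivrMr// mul1r.
Qed.

Lemma T4_inv_le_pb4 : (T4 om X0 X1 Y0 Y1)^-1 <= pb4 om X0 X1 Y0 Y1.
Proof.
apply: le_ereal_inf_tmp => _ [[F G] /= [FC GC sepF sepG] <-].
have c0 := sup_norm_ge0 (Cinfty_c_poisson om FC.1 GC).
have GT : chord_time om X0 X1 G <= T4 om X0 X1 Y0 Y1.
  by apply: ereal_sup_ubound; exists G.
have := le_trans (chord_time_ge FC GC sepF) GT.
set c := sup_norm _ in c0 *; rewrite inver.
case: (T4 om X0 X1 Y0 Y1) => [r| |].
- case: eqP => [//|/eqP cn0].
  have cp : (0 < c)%R by rewrite lt_def cn0.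
  rewrite lee_fin => cr; have rp : (0 < r)%R by apply: lt_le_trans cr;
    rewrite invr_gt0.
  by rewrite inver gt_eqF// lee_fin -[leRHS]invrK lef_pV2// posrE invr_gt0.
- by rewrite invey lee_fin.
- by case: ifP.
Qed.

Hypotheses (cX0 : compact X0) (cX1 : compact X1).

(** Since tau is below the supremum, some admissible G has all its chords longer than tau; the slack
    of [poisson_upper_bound] disappears in the infimum. *)
Lemma pb4_le_inv (tau : R) : (0 < tau)%R -> tau%:E < T4 om X0 X1 Y0 Y1 ->
  pb4 om X0 X1 Y0 Y1 <= (tau^-1)%:E.
Proof.
move=> tau0 /ereal_sup_gt[_ [G [GC sepG] <-] tG].
apply/lee_addgt0Pr => e e0.
have [|F [FC sepF Fe]] := poisson_upper_bound (om := om) cX0 cX1 GC tau0 e0.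
  move=> g t x hg x0 x1; rewrite -lte_fin; apply: lt_le_trans tG _.
  by apply: ereal_inf_lbound; exists t => //; exists g, x.
apply: (@le_trans _ _ (sup_norm (poisson om F G))%:E).
  by apply: ereal_inf_lbound; exists (F, G).
rewrite -EFinD lee_fin; apply: sup_norm_le => //.
by rewrite addr_ge0 ?invr_ge0// ltW.
Qed.

Hypotheses (cY0 : compact Y0) (cY1 : compact Y1) (Y01 : Y0 `&` Y1 = set0).

(** An admissible G exists because Y0 and Y1 are disjoint compact sets; this rules out the value -oo
    of an empty supremum. *)
Lemma T4_ge0 : 0 <= T4 om X0 X1 Y0 Y1.
Proof.
have oY0 : open (~` Y0).
  by rewrite openC; apply: compact_closed cY0; exact: manifold_hausdorff A.
have Y10 : Y1 `<=` ~` Y0 by rewrite -disjoints_subset setIC.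
have [G [GC G01 GY0 GY1]] := manifold_urysohn (A := A) cY1 oY0 Y10.
apply: le_trans (chord_time_ge0 G) _.
apply: ereal_sup_ubound; exists G => //; split=> //; split=> x xY.
  by rewrite leNgt; apply/negP => G0; apply: (GY0 x) xY; rewrite gt_eqF.
by rewrite GY1.
Qed.

Lemma pb4_le_T4_inv : pb4 om X0 X1 Y0 Y1 <= (T4 om X0 X1 Y0 Y1)^-1.
Proof.
have := T4_ge0; have := pb4_le_inv.
case: (T4 om X0 X1 Y0 Y1) => [r H|H _|_]; last by rewrite leeNy_eq.
- rewrite lee_fin le_eqVlt => /orP[/eqP <-|r0]; first by rewrite inve0 leey.
  rewrite inver gt_eqF//; apply/lee_addgt0Pr => e e0.
  have rV : (0 < r^-1)%R by rewrite invr_gt0.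
  (* A time slightly below r, chosen so that its inverse is r^-1 + e. *)
  have := H (r^-1 + e)^-1%R; rewrite invrK -EFinD; apply.
    by rewrite invr_gt0 addr_gt0.
  by rewrite lte_fin -[ltRHS]invrK ltf_pV2 ?posrE ?addr_gt0// ltrDl.
- rewrite invey; apply/lee_addgt0Pr => e e0; rewrite add0e.
  by have := H e^-1%R; rewrite invrK; apply; rewrite ?invr_gt0// ltry.
Qed.

End MainBounds.

Theorem theorem1p11 (R : realType) (n : nat) (M : topologicalType)
    (A : smooth_manifold R n M) (om : symplectic_form A)
    (M_connected : connected [set: M]) (X0 X1 Y0 Y1 : set M)
    (X0_compact : compact X0) (X1_compact : compact X1)
    (Y0_compact : compact Y0) (Y1_compact : compact Y1)
    (X01_disjoint : X0 `&` X1 = set0) (Y01_disjoint : Y0 `&` Y1 = set0) :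
  pb4 om X0 X1 Y0 Y1 = (T4 om X0 X1 Y0 Y1)^-1.
Proof.
apply/le_anti/andP; split; last exact: T4_inv_le_pb4.
exact: pb4_le_T4_inv.
Qed.
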